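(* Let $X\subseteq\mathbb{R}^2$. The lattice $\mathscr{K}^2(X)$ is finite if and only if $X$ is a subconfiguration of $D_{p,q}$ for some integers $p,q$, or $X$ is equivalent to $S_6$.
   Context: Convex hull lattice. $\mathrm{ch}$ denotes the convex hull. $\mathscr{K}^d$ is the lattice of all convex subsets of $\mathbb{R}^d$ with $A\vee B=\mathrm{ch}(A\cup B)$ and $A\wedge B=A\cap B$. For $X\subseteq\mathbb{R}^d$, $\mathscr{K}^d(X)$ is the least sublattice of $\mathscr{K}^d$ containing all singletons $\{x\}$, $x\in X$. Equivalence. For a set of points $X$ and $A\subseteq X$, put $\mathrm{Rch}_X(A)=\mathrm{ch}(A)\cap X$. Two sets of points $X,Y$ are equivalent, $X\equiv Y$, if there is a bijection $f:X\to Y$ with $f(\mathrm{Rch}_X(A))=\mathrm{Rch}_Y(f(A))$ for all $A\subseteq X$. $X$ is a subconfiguration of $Y$ if $X$ is equivalent to some subset of $Y$. The configurations below are considered up to equivalence. Notation: $x{-}y{-}z$ means that $x,y,z$ are distinct, collinear, and $y$ lies between $x$ and $z$; longer chains $x_1{-}\cdots{-}x_m$ mean distinct collinear points in this order on the line. Diamond configuration $D_{p,q}$ ($p,q\ge 0$ integers, $(p,q)\notin\{(0,0),(1,0),(0,1)\}$): a set of $p+q+3$ points in the plane consisting of $p+q+1$ collinear points $a_1{-}\cdots{-}a_p{-}c{-}b_1{-}\cdots{-}b_q$ and two further points $s,s'$, not on the line of those points, such that the segment $ss'$ meets the axis (the segment joining the first and last of the collinear points) exactly in the point $c$. Sporadic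 configuration $S_6$: six points $a,b,c,a',b',c'$ in the plane such that $a{-}a'{-}c'$, $b{-}b'{-}a'$ and $c{-}c'{-}b'$, with no other collinear subsets (of at least three points). *)

(* Defs.v *)
From HB Require Import structures.
From mathcomp Require Import all_boot all_order all_algebra.
From mathcomp Require Import all_classical all_reals.
From mathcomp Require Import convex.

Set Implicit Arguments.
Unset Strict Implicit.
Unset Printing Implicit Defensive.

Import Order.TTheory GRing.Theory Num.Theory.

Local Open Scope classical_set_scope.
Local Open Scope ring_scope.

Section ConvexHullLattice.
Context {R : realType} {d : nat}.
Local Notation V := ('rV[R]_d).
Implicit Types (A B X Y Z : set V) (K : set (set V)).

Definition ch A : set V := smallest (@convex_set R V) A.

(* A sublattice is represented by its set of elements. The empty set is convex,
   so it is an element of the ambient lattice. *)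
Definition sublattice K : Prop :=
  [/\ (forall A, K A -> @convex_set R V A),
      (forall A B, K A -> K B -> K (A `&` B))
    & (forall A B, K A -> K B -> K (ch (A `|` B)))].

Definition convex_lattice X : set (set V) :=
  smallest sublattice [set [set x] | x in X].

Definition Rch X A : set V := ch A `&` X.

Definition equivalent X Y : Prop :=
  exists2 f : V -> V, set_bij X Y f &
    forall A, A `<=` X -> f @` Rch X A = Rch Y (f @` A).

Definition subconfiguration X Y : Prop :=
  exists2 Z, Z `<=` Y & equivalent X Z.

Definition segment (x y : V) : set V :=
  [set (1 - t) *: x + t *: y | t in [set t : R | 0 <= t <= 1]].

Definition line (x y : V) : set V := range (fun t : R => x + t *: (y - x)).

Definition collinear A : Prop :=
  exists p v : V, A `<=` range (fun t : R => p + t *: v).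

(* [:: x_1; ...; x_m] consists of distinct collinear points lying in this order
   on a line. *)
Definition chain (s : seq V) : Prop :=
  [/\ uniq s, collinear [set` s]
    & forall i j k : nat, (i < j)%N -> (j < k)%N -> (k < size s)%N ->
        segment s`_i s`_k s`_j].

End ConvexHullLattice.

Section PlanarConfigurations.
Context {R : realType}.
Local Notation V := ('rV[R]_2).

Definition diamond_index (p q : nat) : Prop :=
  (p, q) \notin [:: (0, 0); (1, 0); (0, 1)]%N.

(* Y is a diamond configuration D_{p,q}; this determines Y up to equivalence.
   The condition on (p, q) gives the axis at least three points, so that its
   line is the one through its first and last points. *)
Definition is_diamond (p q : nat) (Y : set V) : Prop :=
  diamond_index p q /\
  exists (a b : seq V) (c s s' : V),
    let axis := a ++ c :: b in
    let first := head c axis in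
    let final := last c axis in
    [/\ size a = p /\ size b = q,
        chain axis,
        [/\ s <> s', ~ line first final s & ~ line first final s'],
        segment s s' `&` segment first final = [set c]
      & Y = [set` axis ++ [:: s; s']]].

(* Y is a sporadic configuration S_6; this determines Y up to equivalence. *)
Definition is_S6 (Y : set V) : Prop :=
  exists a b c a' b' c' : V,
    [/\ uniq [:: a; b; c; a'; b'; c'],
        Y = [set` [:: a; b; c; a'; b'; c']],
        [/\ chain [:: a; a'; c'], chain [:: b; b'; a'] & chain [:: c; c'; b']]
      & forall A : set V, A `<=` Y -> collinear A -> (`I_3 #<= A)%card ->
          [\/ A = [set a; a'; c'], A = [set b; b'; a'] | A = [set c; c'; b']]].

End PlanarConfigurations.

(* Main.v *)
Require Import Defs.
From mathcomp Require Import all_boot all_order all_algebra.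
From mathcomp Require Import all_classical all_reals.
From mathcomp Require Import convex interval_inference.
From mathcomp Require Import ring lra.

Set Implicit Arguments.
Unset Strict Implicit.
Unset Printing Implicit Defensive.

Import Order.TTheory GRing.Theory Num.Theory.

(* Call a set P of points complete if whenever two segments with endpoints in P
   cross in a single point, that point is in P.  If the lattice of X is finite,
   its one-point elements form a finite complete set containing X, because a
   crossing point is the meet of two joins of singletons.

   Finite complete sets are classified by induction, removing the point farthest
   from the origin: either all points but two lie on a line which weakly separates
   these two, or the set is S_6.  What is used throughout is that if s and v are the only points of P on one side of a line l, then two
   points of P on l cannot lie on the same side of the line s v, since the
   diagonals of the quadrilateral would cross in a further point on that side of
   l.  Adding a point outside the outer triangle of S_6 creates a new crossing
   with an outer edge.

   Conversely, if P is finite and complete then the hulls of subsets of P are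
   closed under intersection: a pair of convex combinations representing the same
   point is a mixture of basic ones, which have at most four nonzero weights, so
   that the point is in P or is the crossing of two segments. *)

Local Open Scope classical_set_scope.
Local Open Scope ring_scope.

(** * Orientation and betweenness *)

Section Orientation.
Context {R : realType}.
Local Notation V := ('rV[R]_2).
Implicit Types (x y z w u v p s : V) (t : R).

(** The predicates [axial] and [pinwheel] describe the actual point set rather than its equivalence
    class. An equivalence compares hulls only inside the two sets and says nothing about crossing
    points outside them, so finiteness of the lattice does not pass along it formally. Hence the
    shape is first recovered for X itself. This is delicate when the crossing point c of the diamond
    is missing from the image of X, because then no point of X records that s and s' lie on opposite
    sides of the axis.

    The farthest point is a convenient extreme point, and extremeness is used twice: no crossing of
    segments between the other points can equal it, so its removal preserves completeness, and it
    cannot lie in the outer triangle of an S_6 formed by the others.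

    Up to one global sign, the orientations of all triples in S_6 do not depend on its shape, so
    questions about it become finite computations on a table of integers.

    In the converse, four is the number of linear equations on a pair of convex combinations: two
    total weights and two coordinates. *)

Definition orient x y z : R :=
  (y 0 0 - x 0 0) * (z 0 1 - x 0 1) - (y 0 1 - x 0 1) * (z 0 0 - x 0 0).

Definition sbetween x p y : Prop :=
  exists2 t : R, 0 < t < 1 & p = (1 - t) *: x + t *: y.

Definition sqdist x y : R := (x 0 0 - y 0 0) ^+ 2 + (x 0 1 - y 0 1) ^+ 2.

Lemma rv2P x y : x 0 0 = y 0 0 -> x 0 1 = y 0 1 -> x = y.
Proof.
move=> e0 e1; apply/rowP => -[[|[|//]] i].
  by have -> : Ordinal i = 0 by apply: val_inj.
by have -> : Ordinal i = 1 by apply: val_inj.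
Qed.

Lemma orient_affine u w x y t :
  orient u w ((1 - t) *: x + t *: y) = (1 - t) * orient u w x + t * orient u w y.
Proof. by rewrite /orient !mxE; ring. Qed.

Lemma orient_param u v w t :
  orient u w (u + t *: (w - u)) = 0.
Proof. by rewrite /orient !mxE; ring. Qed.

Lemma orientC x y z : orient x z y = - orient x y z.
Proof. by rewrite /orient; ring. Qed.

Lemma orient_cycle x y z : orient y z x = orient x y z.
Proof. by rewrite /orient; ring. Qed.

Lemma orient_xxy x y : orient x x y = 0.
Proof. by rewrite /orient; ring. Qed.

Lemma orient_xyx x y : orient x y x = 0.
Proof. by rewrite /orient; ring. Qed.

Lemma orient_xyy x y : orient x y y = 0.
Proof. by rewrite /orient; ring. Qed.

Lemma sqdist_ge0 x y : 0 <= sqdist x y.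
Proof. by rewrite addr_ge0 ?sqr_ge0. Qed.

Lemma sqdist_eq0 x y : (sqdist x y == 0) = (x == y).
Proof.
rewrite /sqdist paddr_eq0 ?sqr_ge0// !sqrf_eq0 !subr_eq0.
by apply/andP/eqP => [[/eqP a /eqP b]|->//]; apply: rv2P.
Qed.

Lemma lineP u w x : u != w -> orient u w x = 0 ->
  exists t, x = u + t *: (w - u).
Proof.
move=> uw; rewrite /orient => e.
have d0 : sqdist w u != 0 by rewrite sqdist_eq0 eq_sym.
set n := (x 0 0 - u 0 0) * (w 0 0 - u 0 0) + (x 0 1 - u 0 1) * (w 0 1 - u 0 1).
exists (n / sqdist w u).
apply: rv2P; rewrite !mxE; apply: (mulIf d0); rewrite mulrDl mulrAC mulfVK//.
  apply/eqP; rewrite -subr_eq0; apply/eqP.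
  rewrite -[RHS](mulr0 (- (w 0 1 - u 0 1))) -e /n /sqdist; ring.
apply/eqP; rewrite -subr_eq0; apply/eqP.
rewrite -[RHS](mulr0 (w 0 0 - u 0 0)) -e /n /sqdist; ring.
Qed.

(** With [p] at parameter [t] on the line through [x] and [y], the product is [t * (1 - t)] times a
    square, hence positive only for [0 < t < 1]. *)
Lemma sbetween_level u w x p y : orient x y p = 0 ->
  0 < (orient u w x - orient u w p) * (orient u w p - orient u w y) ->
  sbetween x p y.
Proof.
move=> o0 d; have xy : x != y.
  apply/eqP => xy; move: d; rewrite xy -[X in X * _]opprB mulNr oppr_gt0.
  by rewrite ltNge sqr_ge0.
have [t pE] := lineP xy o0.
have pE' : p = (1 - t) *: x + t *: y by apply: rv2P; rewrite pE !mxE; ring.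
exists t => //; move: d; rewrite pE' orient_affine.
set a := orient u w x; set b := orient u w y.
rewrite (_ : _ * _ = (t * (1 - t)) * (a - b) ^+ 2); last by ring.
move=> d; have {d} : 0 < t * (1 - t).
  by rewrite ltNge; apply/negP => h; move: d; rewrite ltNge mulr_le0_ge0 ?sqr_ge0.
by nra.
Qed.

Lemma sbetween_zero u w x p y : orient x y p = 0 -> orient u w p = 0 ->
  orient u w x * orient u w y < 0 -> sbetween x p y.
Proof.
by move=> o0 p0 xy; apply: (@sbetween_level u w) => //; rewrite p0; lra.
Qed.

Lemma sbetween_orient u w x p y : sbetween x p y ->
  exists2 t, 0 < t < 1 & orient u w p = (1 - t) * orient u w x + t * orient u w y.
Proof. by move=> [t t01 ->]; exists t; rewrite // orient_affine. Qed.

Lemma sbetween_online x p y : sbetween x p y -> orient x y p = 0.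
Proof.
by move=> /(sbetween_orient x y)[t _ ->]; rewrite orient_xyx orient_xyy; ring.
Qed.

Lemma sbetweenC x p y : sbetween x p y -> sbetween y p x.
Proof.
move=> [t t01 ->]; exists (1 - t); first by lra.
by rewrite subKr addrC.
Qed.

Lemma crossing x y z w :
  orient x y z * orient x y w < 0 -> orient z w x * orient z w y < 0 ->
  exists2 p, sbetween x p y & sbetween z p w.
Proof.
move=> o1 o2.
have D0 : orient z w x - orient z w y != 0 by apply/eqP; nra.
(* The parameter is the zero of the affine function [orient z w] along [x y]. The one given below
   for the other segment is the zero of [orient x y] along [z w]. *)
exists ((1 - orient z w x / (orient z w x - orient z w y)) *: x
        + (orient z w x / (orient z w x - orient z w y)) *: y).
  exists (orient z w x / (orient z w x - orient z w y)) => //.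
  move: D0 o2; set a := orient z w x; set b := orient z w y => D0 o2.
  have [a0|a0|a0] := ltgtP a 0.
  - by rewrite ltr_ndivlMr ?ltr_ndivrMr; nra.
  - by rewrite ltr_pdivlMr ?ltr_pdivrMr; nra.
  - by rewrite a0 in o2; lra.
exists (orient x y z / (orient x y z - orient x y w)).
  move: o1; set a := orient x y z; set b := orient x y w => o1.
  have [a0|a0|a0] := ltgtP a 0.
  - by rewrite ltr_ndivlMr ?ltr_ndivrMr; nra.
  - by rewrite ltr_pdivlMr ?ltr_pdivrMr; nra.
  - by rewrite a0 in o1; lra.
(* Both denominators are, up to sign, the cross product of the two directions. *)
have e : orient x y z - orient x y w = - (orient z w x - orient z w y).
  by rewrite /orient; ring.
rewrite e; apply: rv2P; rewrite !mxE; by move: D0; rewrite /orient => D0; field.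
Qed.

End Orientation.

(** * Finite sets closed under crossings of segments *)

Section Complete.
Context {R : realType}.
Local Notation V := ('rV[R]_2).
Implicit Types (x y z w u v p s : V) (t : R) (P : set V).

(** [orient x y z != 0] keeps the two segments off a common line, so that they meet in [p] only. *)
Definition complete P : Prop :=
  forall x y z w p, P x -> P y -> P z -> P w -> orient x y z != 0 ->
    sbetween x p y -> sbetween z p w -> P p.

(** [s] and [s'] need not belong to [P] and may lie on the axis. So the notion passes to subsets,
    and any axis point can stand in for an absent [s] or [s']. *)
Definition axial P : Prop :=
  exists u w s s', [/\ u != w, (forall x, P x -> [\/ orient u w x = 0, x = s | x = s'])
    & orient u w s * orient u w s' <= 0].

(* S_6; the absence of further collinear triples follows. *)
Definition pinwheel P : Prop :=
  exists a b c a' b' c', [/\ orient a' b' c' != 0,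
    sbetween a a' c', sbetween b b' a', sbetween c c' b'
    & P = [set` [:: a; b; c; a'; b'; c']]].

Lemma complete_crossing P x y z w : complete P -> P x -> P y -> P z -> P w ->
  orient x y z * orient x y w < 0 -> orient z w x * orient z w y < 0 ->
  exists p, [/\ P p, sbetween x p y & sbetween z p w].
Proof.
move=> cP Px Py Pz Pw o1 o2; have [p xpy zpw] := crossing o1 o2.
exists p; split=> //; apply: (cP x y z w) => //.
by apply/eqP => o0; rewrite o0 mul0r ltxx in o1.
Qed.

Lemma orient_sub_line u w x y : u != w -> x != y ->
  orient u w x = 0 -> orient u w y = 0 ->
  exists2 k : R, k != 0 & forall s, orient x y s = k * orient u w s.
Proof.
move=> uw xy /(lineP uw)[t xE] /(lineP uw)[r yE]; exists (r - t).
  rewrite subr_eq0; apply: contra_neq xy => e.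
  by rewrite xE yE e.
by move=> z; rewrite xE yE /orient !mxE; ring.
Qed.

Lemma same_sign_trans (a b c : R) : 0 < a * b -> 0 < b * c -> 0 < a * c.
Proof.
move=> ab bc; have : 0 < a * c * b ^+ 2.
  by rewrite (_ : _ * _ = (a * b) * (b * c)); [rewrite mulr_gt0 | ring].
by rewrite pmulr_lgt0// lt_neqAle sqr_ge0 andbT eq_sym sqrf_eq0; apply/eqP => b0;
  rewrite b0 mul0r ltxx in bc.
Qed.

Lemma opp_sign_trans (a b c : R) : a * b < 0 -> 0 < b * c -> a * c < 0.
Proof.
move=> ab bc; rewrite -oppr_gt0 -mulNr; apply: (@same_sign_trans _ b) => //.
by rewrite mulNr oppr_gt0.
Qed.

Lemma mulrr_gt0 (a b : R) : 0 < a * b -> 0 < a * a.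
Proof.
move=> ab; rewrite -expr2 lt_neqAle sqr_ge0 andbT eq_sym sqrf_eq0.
by apply/eqP => a0; rewrite a0 mul0r ltxx in ab.
Qed.

(* Four points such that both lines s v and x y leave the other two points on
   one side are in convex position, with s v and x y as opposite sides. *)
Lemma convex_position_diagonals s v x y :
  0 < orient s v x * orient s v y -> 0 < orient x y s * orient x y v ->
  (orient s x v * orient s x y < 0 /\ orient v y s * orient v y x < 0) \/
  (orient s y v * orient s y x < 0 /\ orient v x s * orient v x y < 0).
Proof.
have e1 : orient s x v = - orient s v x by rewrite /orient; ring.
have e2 : orient s x y = orient x y s by rewrite /orient; ring.
have e3 : orient v y s = orient s v y by rewrite /orient; ring.
have e4 : orient v y x = - orient x y v by rewrite /orient; ring.
have e5 : orient s y v = - orient s v y by rewrite /orient; ring.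
have e6 : orient s y x = - orient x y s by rewrite /orient; ring.
have e7 : orient v x s = orient s v x by rewrite /orient; ring.
have e8 : orient v x y = orient x y v by rewrite /orient; ring.
rewrite e1 e2 e3 e4 e5 e6 e7 e8.
move: (orient s v x) (orient s v y) (orient x y s) (orient x y v) => a b c d.
move=> ab cd; have ba : 0 < b * a by rewrite mulrC.
have [ac|ac|ac] := ltgtP (a * c) 0; [right|left|].
- have bc : b * c < 0 by rewrite mulrC; apply: (@opp_sign_trans _ a) => //; rewrite mulrC.
  split; first by rewrite mulrNN.
  exact: (@opp_sign_trans _ c).
- split; first by rewrite mulNr oppr_lt0.
  rewrite mulrN oppr_lt0; apply: (@same_sign_trans _ c) => //.
  exact: (@same_sign_trans _ a).
- by exfalso; move/eqP: ac; rewrite mulf_eq0 => /orP[]/eqP a0; move: ab cd;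
    rewrite a0 !mul0r ltxx.
Qed.

(* Two such points x and y would give a crossing of the diagonals of the
   quadrilateral s, v, x, y off the line u w. *)
Lemma same_side_unique P u w s v x y : complete P -> u != w ->
  P s -> P v -> 0 < orient u w s * orient u w v ->
  (forall p, P p -> 0 < orient u w s * orient u w p -> p = s \/ p = v) ->
  P x -> P y -> orient u w x = 0 -> orient u w y = 0 ->
  0 < orient s v x * orient s v y -> x = y.
Proof.
move=> cP uw Ps Pv sv sideP Px Py x0 y0 gxy; apply/eqP; apply: contraT => xy.
have [k k0 oxy] := orient_sub_line uw xy x0 y0.
have fxy : 0 < orient x y s * orient x y v.
  rewrite !oxy (_ : _ * _ = k ^+ 2 * (orient u w s * orient u w v)); last by ring.
  by rewrite mulr_gt0// lt_neqAle sqr_ge0 andbT eq_sym sqrf_eq0.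
have key a b : P a -> P b -> orient u w a = 0 -> orient u w b = 0 ->
    orient s a v * orient s a b < 0 -> orient v b s * orient v b a < 0 -> false.
  move=> Pa Pb a0 b0 o1 o2.
  have [p [Pp sap vbp]] := complete_crossing cP Ps Pa Pv Pb o1 o2.
  have [||pE|pE] // := sideP p.
  - have [t t01 ->] := sbetween_orient u w sap; rewrite a0 mulr0 addr0 mulrCA.
    rewrite mulr_gt0 ?subr_gt0 ?(mulrr_gt0 sv)//; by case/andP: t01.
  - by move: o2; rewrite -pE (sbetween_online vbp) mul0r ltxx.
  - by move: o1; rewrite -pE (sbetween_online sap) mul0r ltxx.
by have [[]|[]] := convex_position_diagonals gxy fxy; apply: key.
Qed.

(** Serves to name the only point on a side of a line. For an empty side, [d] is taken on the line,
    where both weak sign conditions hold. *)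
Lemma exists_or_default (Q : V -> Prop) (d : V) :
  exists x, (Q x \/ x = d) /\ (forall y, Q y -> Q x).
Proof.
have [[x Qx]|nQ] := pselect (exists x, Q x); first by exists x; split; [left|].
by exists d; split; [right|move=> y Qy; case: nQ; exists y].
Qed.

(** The line [s v] takes over as axis: by [same_side_unique] at most one point of the old axis is
    left on each side of it. *)
Lemma two_same_side_axial P u w s v : complete P -> u != w ->
  P s -> P v -> 0 < orient u w s * orient u w v ->
  (forall p, P p -> [\/ orient u w p = 0, p = s | p = v]) -> axial P.
Proof.
move=> cP uw Ps Pv sv offP.
have [svE|sneqv] := eqVneq s v.
  exists u, w, s, u; split=> //; last by rewrite orient_xyx mulr0.
  by move=> x /offP[e|e|e]; [apply: Or31|apply: Or32|apply: Or32; rewrite svE].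
have sideP p : P p -> 0 < orient u w s * orient u w p -> p = s \/ p = v.
  by move=> /offP[->|->|->] //; rewrite ?mulr0 ?ltxx; auto.
have uniqP := same_side_unique cP uw Ps Pv sv sideP.
pose side (c : R) x := [/\ P x, orient u w x = 0 & 0 < c * orient s v x].
have sideE c x y : side c x -> side c y -> x = y.
  move=> [Px x0 gx] [Py y0 gy]; apply: uniqP => //.
  by apply: (@same_sign_trans _ c) => //; rewrite mulrC.
have [a [aE aP]] := exists_or_default (side 1) s.
have [b [bE bP]] := exists_or_default (side (-1)) s.
have ga : 0 <= orient s v a.
  by case: aE => [[_ _]|->]; rewrite ?mul1r ?orient_xyx// => /ltW.
have gb : orient s v b <= 0.
  by case: bE => [[_ _]|->]; rewrite ?mulN1r ?oppr_gt0 ?orient_xyx// => /ltW.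
exists s, v, a, b; split=> //; last by rewrite mulr_ge0_le0.
move=> x Px; case: (offP x Px) => [x0|->|->]; last 2 first.
- by rewrite orient_xyx; exact: Or31.
- by rewrite orient_xyy; exact: Or31.
have [g0|g0|->] := ltgtP (orient s v x) 0; last exact: Or31.
- have sx : side (-1) x by split; rewrite ?mulN1r ?oppr_gt0.
  by apply: Or33; apply: sideE sx (bP _ sx).
- have sx : side 1 x by split; rewrite ?mul1r.
  by apply: Or32; apply: sideE sx (aP _ sx).
Qed.

(* Linear relation between the three displacements s -> v, s -> s' and s -> x,
   evaluated by [orient u w]. *)
Lemma orient_three_term u w s v s' x :
  (orient u w v - orient u w s) * orient s s' x =
  (orient u w s' - orient u w s) * orient s v x
  - (orient u w x - orient u w s) * orient s v s'.
Proof. by rewrite /orient; ring. Qed.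

Lemma mulrr_gt0_neq0 (a : R) : a != 0 -> 0 < a * a.
Proof. by move=> a0; rewrite -expr2 lt_neqAle sqr_ge0 andbT eq_sym sqrf_eq0. Qed.

(** Completeness forces [x1] onto the segment [s s']. What then decides between the two shapes is
    whether the point where the line [s v] meets the axis belongs to [P]. *)
Lemma two_plus_one_crossed P u w s v s' x1 x2 : complete P -> u != w ->
  P s -> P v -> P s' -> P x1 -> P x2 ->
  0 < orient u w s -> orient u w s < orient u w v -> orient u w s' < 0 ->
  orient u w x1 = 0 -> orient u w x2 = 0 ->
  0 < orient s v s' * orient s v x1 -> orient s v s' * orient s v x2 < 0 ->
  (forall p, P p -> (orient u w p = 0 /\ orient s v p = 0) \/
                    p \in [:: s; v; s'; x1; x2]) ->
  axial P \/ pinwheel P.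
Proof.
move=> cP uw Ps Pv Ps' Px1 Px2 s0 sv s'0 x10 x20 g1 g2 offP.
have v0 := lt_trans s0 sv.
have K0 : orient s v s' != 0 by apply/eqP => e; rewrite e mul0r ltxx in g1.
have g10 : orient s v x1 != 0 by apply/eqP => e; rewrite e mulr0 ltxx in g1.
have ssv : orient s s' v = - orient s v s' by rewrite orientC.
have x12 : x1 != x2 by apply/eqP => e; rewrite e in g1; move: g1; rewrite ltNge ltW.
have ss' : s != s' by apply/eqP => e; move: s0; rewrite e ltNge ltW.
have o2 : 0 < orient s v s' * orient s s' x2.
  have := orient_three_term u w s v s' x2; rewrite x20 => e.
  have d : 0 < orient u w v - orient u w s by rewrite subr_gt0.
  rewrite -(pmulr_rgt0 _ d) mulrCA e mulrBr addr_gt0//.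
    by rewrite mulrCA nmulr_rgt0// subr_lt0 (lt_trans s'0).
  by rewrite mulrCA sub0r mulNr opprK mulr_gt0// mulrr_gt0_neq0.
have Pupper p : P p -> 0 < orient u w p -> p = s \/ p = v.
  move=> /offP[[-> _]|]; first by rewrite ltxx.
  rewrite !inE => /or4P[/eqP->|/eqP->|/eqP->|/orP[]/eqP->]; auto.
  - by rewrite ltNge ltW.
  - by rewrite x10 ltxx.
  - by rewrite x20 ltxx.
have f12 : orient x1 x2 s * orient x1 x2 s' < 0.
  have [k k0 kE] := orient_sub_line uw x12 x10 x20.
  by rewrite !kE mulrACA pmulr_rlt0 ?mulrr_gt0_neq0// pmulr_rlt0.
(* If the line [s s'] separated [x1] from [x2], the segment [s s'] would cross the axis in a point
   of [P] that is neither on the line [s v] nor on the list. If both were on one side of it, [s s']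
   and [v x1] would cross above the axis, where [s] and [v] are the only points. *)
have o1 : orient s s' x1 = 0.
  suff /eqP : orient s v s' * orient s s' x1 = 0.
    by rewrite mulf_eq0 (negPf K0) => /eqP.
  have [o1|o1|//] := ltgtP (orient s v s' * orient s s' x1) 0; exfalso.
  - have o12 : orient s s' x1 * orient s s' x2 < 0.
      by apply: (@opp_sign_trans _ (orient s v s')) => //; rewrite mulrC.
    have [p [Pp ssp xxp]] := complete_crossing cP Ps Ps' Px1 Px2 o12 f12.
    have fp : orient u w p = 0.
      by have [t _ ->] := sbetween_orient u w xxp; rewrite x10 x20 !mulr0 addr0.
    have op := sbetween_online ssp.
    case: (offP p Pp) => [[_]|].
      have [t /andP[t0 _] ->] := sbetween_orient s v ssp.
      rewrite orient_xyx mulr0 add0r => /eqP; rewrite mulf_eq0 (negPf K0) orbF.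
      by rewrite gt_eqF.
    rewrite !inE => /or4P[/eqP pE|/eqP pE|/eqP pE|/orP[]/eqP pE]; subst p.
    + by rewrite fp ltxx in s0.
    + by rewrite fp ltxx in v0.
    + by rewrite fp ltxx in s'0.
    + by rewrite op mulr0 ltxx in o1.
    + by rewrite op mulr0 ltxx in o2.
  - have o3 : orient s s' v * orient s s' x1 < 0 by rewrite ssv mulNr oppr_lt0.
    have vx1s : orient v x1 s = orient s v x1 by rewrite /orient; ring.
    have o4 : orient v x1 s * orient v x1 s' < 0.
      rewrite vx1s mulrC; apply: (@opp_sign_trans _ (orient s v s')) => //.
      have e : orient v x1 s' = orient s v x1 - orient s s' x1 - orient s v s'.
        by rewrite /orient; ring.
      have := orient_three_term u w s v s' x1; rewrite x10 sub0r mulNr opprK e.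
      have := mulrr_gt0_neq0 K0.
      move: g1 o1 s0 sv s'0.
      set K := orient s v s'; set O := orient s s' x1; set G := orient s v x1.
      move: (orient u w s) (orient u w v) (orient u w s') => A B C G0 O0 A0 AB C0 KK E.
      have {}E : (B - A) * (K * O) = (C - A) * (K * G) + A * (K * K).
        by rewrite [LHS]mulrCA E; ring.
      (* Otherwise [K * G] is at least [K * O + K * K]. As [C - A < 0], the identity [E] then bounds
         the positive [(B - A) * (K * O)] by [(C - A) * (K * O) + C * (K * K)], which is
         negative. *)
      rewrite ltNge; apply/negP => h.
      have h' : K * O + K * K <= K * G by move: h; lra.
      have l : (C - A) * (K * G) <= (C - A) * (K * O + K * K).
        by rewrite ler_nM2l// subr_lt0 (lt_trans C0).
      have : 0 < (B - A) * (K * O) by rewrite mulr_gt0 ?subr_gt0.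
      by move: E l; nra.
    have [p [Pp ssp vxp]] := complete_crossing cP Ps Ps' Pv Px1 o3 o4.
    have [|pE|pE] := Pupper p Pp.
    + have [t /andP[_ t1] ->] := sbetween_orient u w vxp.
      by rewrite x10 mulr0 addr0 mulr_gt0// subr_gt0.
    + by move: g10; rewrite -vx1s -pE (sbetween_online vxp) eqxx.
    + by move: K0; rewrite -[orient s v s']opprK -ssv -pE (sbetween_online ssp) oppr0 eqxx.
have sx1 : sbetween s x1 s'.
  by apply: (@sbetween_zero _ u w) => //; rewrite pmulr_rlt0.
have s_v : s != v by apply/eqP => e; move: K0; rewrite e orient_xxy eqxx.
have [[x0 [Px0 [f0 g0]]]|nx0] :=
  pselect (exists x0, P x0 /\ orient u w x0 = 0 /\ orient s v x0 = 0); last first.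
  (* The line [s s'] carries [x1] and separates [v] from [x2]. *)
  left; exists s, s', v, x2; split=> //; last by rewrite ssv mulNr oppr_le0 ltW.
  move=> p Pp; case: (offP p Pp) => [e|]; first by case: nx0; exists p.
  rewrite !inE => /or4P[/eqP->|/eqP->|/eqP->|/orP[]/eqP->].
  - by apply: Or31; rewrite orient_xyx.
  - exact: Or32.
  - by apply: Or31; rewrite orient_xyy.
  - exact: Or31.
  - exact: Or33.
(* The three chains are [x2], [x0], [x1] on the axis, then [v], [s], [x0], and finally [s'], [x1],
   [s]. *)
right; exists x2, v, s', x0, s, x1; split.
- have x01 : x0 != x1 by apply/eqP => e; rewrite -e g0 eqxx in g10.
  have [k k0 kE] := orient_sub_line uw x01 f0 x10.
  by rewrite orientC kE oppr_eq0 mulf_neq0// gt_eqF.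
- have [k k0 kE] := orient_sub_line uw x12 x10 x20.
  apply: sbetweenC; apply: (@sbetween_zero _ s v) => //; first by rewrite kE f0 mulr0.
  by rewrite mulrC; apply: (@opp_sign_trans _ (orient s v s')) => //; rewrite mulrC.
- apply: (@sbetween_level _ u w); first by rewrite orientC -orient_cycle orientC opprK.
  by rewrite f0 subr0 mulr_gt0// subr_gt0.
- exact: sbetweenC.
- apply/seteqP; split=> [p Pp|p]; rewrite /= !inE.
  + case: (offP p Pp) => [[fp gp]|]; last first.
      by rewrite !inE => /or4P[|||/orP[]] ->; rewrite ?orbT.
    suff -> : p = x0 by rewrite eqxx !orbT.
    apply/eqP; apply: contraT => px0.
    have [k k0 kE] := orient_sub_line uw px0 fp f0.
    have [k' k'0 k'E] := orient_sub_line s_v px0 gp g0.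
    have := kE s; rewrite k'E orient_xyx mulr0 => /esym/eqP.
    by rewrite mulf_eq0 (negPf k0) gt_eqF.
  + by move=> /or4P[/eqP->|/eqP->|/eqP->|/or3P[]/eqP->].
Qed.

(** The line [s v] is tried as the new axis: by [same_side_unique] each side of it has at most one
    old axis point, so at most three points are off it. Only when [s'] is off it and both sides have
    an axis point is [two_plus_one_crossed] needed. *)
Lemma two_plus_one P u w s v s' : complete P -> u != w ->
  P s -> P v -> P s' -> 0 < orient u w s -> 0 < orient u w v -> orient u w s' < 0 ->
  (forall p, P p -> [\/ orient u w p = 0, p = s, p = v | p = s']) ->
  axial P \/ pinwheel P.
Proof.
move=> cP uw Ps Pv Ps' s0 v0 s'0 offP.
have [svE|sneqv] := eqVneq s v.
  left; exists u, w, s, s'; split=> //; last by nra.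
  by move=> x /offP[e|e|e|e]; [apply: Or31|apply: Or32|apply: Or32; rewrite svE|apply: Or33].
have sv : 0 < orient u w s * orient u w v by rewrite mulr_gt0.
have sideP p : P p -> 0 < orient u w s * orient u w p -> p = s \/ p = v.
  by move=> /offP[->|->|->|->];
    rewrite ?mulr0 ?ltxx ?pmulr_rgt0 ?[0 < orient u w s']ltNge ?(ltW s'0); auto.
have uniqP := same_side_unique cP uw Ps Pv sv sideP.
pose side (c : R) x := [/\ P x, orient u w x = 0 & 0 < c * orient s v x].
have sideE c x y : side c x -> side c y -> x = y.
  move=> [Px x0 gx] [Py y0 gy]; apply: uniqP => //.
  by apply: (@same_sign_trans _ c) => //; rewrite mulrC.
have onL x : P x -> orient u w x = 0 \/ (orient s v x = 0 \/ x = s').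
  by move=> /offP[e|->|->|->]; rewrite ?orient_xyx ?orient_xyy; auto.
(* [c] makes the side of [s'] the positive one. If [s'] is on the line [s v], either orientation
   will do. *)
pose c := if orient s v s' == 0 then 1 else orient s v s'.
have c0 : c != 0 by rewrite /c; case: ifPn; rewrite ?oner_eq0.
have onSide x : P x -> orient u w x = 0 ->
    [\/ orient s v x = 0, side c x | side (- c) x].
  move=> Px x0; have [g0|g0|g0] := ltgtP (c * orient s v x) 0.
  - by apply: Or33; split; rewrite ?mulNr ?oppr_gt0.
  - exact: Or32.
  - by apply: Or31; move/eqP: g0; rewrite mulf_eq0 (negPf c0) => /eqP.
have [a [aE aP]] := exists_or_default (side c) s.
have [b [bE bP]] := exists_or_default (side (- c)) s.
have ga : 0 <= c * orient s v a.
  by case: aE => [[_ _]|->]; rewrite ?orient_xyx ?mulr0// => /ltW.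
have gb : c * orient s v b <= 0.
  by case: bE => [[_ _]|->]; rewrite ?mulNr ?oppr_gt0 ?orient_xyx ?mulr0// => /ltW.
have cc : 0 < c * c by rewrite mulrr_gt0_neq0.
have [K0|K0] := eqVneq (orient s v s') 0.
  left; exists s, v, a, b; split=> //; last first.
    by rewrite -(pmulr_rle0 _ cc) mulrACA mulr_ge0_le0.
  move=> x Px; case: (onL x Px) => [x0|[x0|->]]; [|exact: Or31|exact: Or31].
  case: (onSide x Px x0) => [|sx|sx]; first exact: Or31.
  - by apply: Or32; apply: sideE sx (aP _ sx).
  - by apply: Or33; apply: sideE sx (bP _ sx).
have cE : c = orient s v s' by rewrite /c (negPf K0).
have [[x1 sx1]|nx1] := pselect (exists x, side c x); last first.
  left; exists s, v, s', b; split=> //; last by rewrite -cE.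
  move=> x Px; case: (onL x Px) => [x0|[x0|->]]; [|exact: Or31|exact: Or32].
  case: (onSide x Px x0) => [|sx|sx]; first exact: Or31.
  - by case: nx1; exists x.
  - by apply: Or33; apply: sideE sx (bP _ sx).
have [Px1 x10 gx1] := sx1.
have [[x2 sx2]|nx2] := pselect (exists x, side (- c) x); last first.
  left; apply: (@two_same_side_axial P s v x1 s') => //.
    by rewrite mulrC -cE.
  move=> x Px; case: (onL x Px) => [x0|[x0|->]]; [|exact: Or31|exact: Or33].
  case: (onSide x Px x0) => [|sx|sx]; first exact: Or31.
  - by apply: Or32; apply: sideE sx sx1.
  - by case: nx2; exists x.
have [Px2 x20 gx2] := sx2.
have g1 : 0 < orient s v s' * orient s v x1 by rewrite -cE.
have g2 : orient s v s' * orient s v x2 < 0 by rewrite -oppr_gt0 -mulNr -cE.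
have offP' p : P p -> (orient u w p = 0 /\ orient s v p = 0) \/
    p \in [:: s; v; s'; x1; x2].
  move=> Pp; case: (offP p Pp) => [p0|->|->|->]; rewrite !inE ?eqxx ?orbT; auto.
  case: (onSide p Pp p0) => [|sp|sp]; auto; right.
  - by rewrite (sideE _ _ _ sp sx1) eqxx !orbT.
  - by rewrite (sideE _ _ _ sp sx2) eqxx !orbT.
have [fsv|fsv|fsv] := ltgtP (orient u w s) (orient u w v).
- exact: (@two_plus_one_crossed P u w s v s' x1 x2).
- have gN x : orient v s x = - orient s v x by rewrite /orient; ring.
  apply: (@two_plus_one_crossed P u w v s s' x1 x2) => //.
  + by rewrite !gN mulrNN.
  + by rewrite !gN mulrNN.
  + move=> p /offP'[[p0 gp]|]; first by left; rewrite gN gp oppr0.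
    by rewrite !inE => /or4P[|||/orP[]] ->; rewrite ?orbT; right.
(* At equal heights [s v] is parallel to the axis, which then lies entirely on the side of [s'],
   against [g2]. *)
- have := orient_three_term u w s v s' x2.
  rewrite fsv subrr mul0r x20 => e; exfalso.
  have : 0 < orient s v s' * ((orient u w s' - orient u w v) * orient s v x2
            - (0 - orient u w v) * orient s v s').
    rewrite sub0r mulNr opprK mulrDr addr_gt0//.
      by rewrite mulrCA nmulr_rgt0// subr_lt0 (lt_trans s'0).
    by rewrite mulrCA mulr_gt0// mulrr_gt0_neq0.
  by rewrite -e mulr0 ltxx.
Qed.

End Complete.

(** * Signs in the pinwheel *)

Section PinwheelCoordinates.

Definition det3 (T : comPzRingType) (p q r : T * T * T) : T :=
  let: (p1, p2, p3) := p in let: (q1, q2, q3) := q in let: (r1, r2, r3) := r in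
  p1 * (q2 * r3 - q3 * r2) - p2 * (q1 * r3 - q3 * r1) + p3 * (q1 * r2 - q2 * r1).

(* Barycentric coordinates with respect to the inner triangle a' b' c' of the
   points a, b, c, a', b', c'. *)
Definition pinwheel_coord (T : comPzRingType) (x y z : T) (i : nat) : T * T * T :=
  match i with
  | 0%N => (1 + x, 0, - x)
  | 1%N => (- y, 1 + y, 0)
  | 2%N => (0, - z, 1 + z)
  | 3%N => (1, 0, 0)
  | 4%N => (0, 1, 0)
  | _ => (0, 0, 1)
  end.

(* The signs do not depend on the parameters, so they are those at x = y = z = 1. *)
Definition pinwheel_sign (i j k : nat) : int :=
  let q := @pinwheel_coord int 1 1 1 in sgz (det3 (q i) (q j) (q k)).

(** Each determinant expands to a polynomial whose nonzero coefficients all have one sign; the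
    negative term in [x * y * z] of the outer triangle cancels. Hence linear arithmetic suffices
    once the products of the parameters are known to be positive. *)
Lemma pinwheel_det3_sign (R : realFieldType) (x y z : R) (i j k : nat) :
  0 < x -> 0 < y -> 0 < z -> (i < 6)%N -> (j < 6)%N -> (k < 6)%N ->
  let q := pinwheel_coord x y z in
  sgz (det3 (q i) (q j) (q k)) = pinwheel_sign i j k.
Proof.
move=> x0 y0 z0; have xy := mulr_gt0 x0 y0; have yz := mulr_gt0 y0 z0.
have xz := mulr_gt0 x0 z0; have xyz := mulr_gt0 xy z0.
case: i => [|[|[|[|[|[|//]]]]]] _; case: j => [|[|[|[|[|[|//]]]]]] _;
case: k => [|[|[|[|[|[|//]]]]]] _; cbv zeta;
match goal with |- _ = pinwheel_sign ?i ?j ?k =>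
  let s := eval vm_compute in (pinwheel_sign i j k) in
  change (pinwheel_sign i j k) with s
end; rewrite /det3 /pinwheel_coord;
match goal with
 | |- _ = Posz 1 => rewrite gtr0_sgz //; lra
 | |- _ = Posz 0 => apply/eqP; rewrite sgz_eq0; apply/eqP; ring
 | |- _ => rewrite ltr0_sgz //; lra
end.
Qed.

Definition pinwheel_crossing (i j k l : nat) : bool :=
  (pinwheel_sign i j k * pinwheel_sign i j l == -1) &&
  (pinwheel_sign k l i * pinwheel_sign k l j == -1).

Lemma pinwheel_no_crossing i j k l : (i < 6)%N -> (j < 6)%N -> (k < 6)%N -> (l < 6)%N ->
  ~~ pinwheel_crossing i j k l.
Proof.
have H : all (fun i => all (fun j => all (fun k => all (fun l =>
  ~~ pinwheel_crossing i j k l) (iota 0 6)) (iota 0 6)) (iota 0 6)) (iota 0 6).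
  by vm_compute.
move=> i6 j6 k6 l6; move/allP: H => /(_ i); rewrite mem_iota => /(_ i6).
move/allP => /(_ j); rewrite mem_iota => /(_ j6).
move/allP => /(_ k); rewrite mem_iota => /(_ k6).
by move/allP => /(_ l); rewrite mem_iota => /(_ l6).
Qed.

End PinwheelCoordinates.

(** * Completeness of the pinwheel and points outside a triangle *)

Section Pinwheel.
Context {R : realType}.
Local Notation V := ('rV[R]_2).
Implicit Types (x y z w u v p s : V) (t : R) (P : set V).

Definition bary (a b c : V) (q : R * R * R) : V :=
  q.1.1 *: a + q.1.2 *: b + q.2 *: c.

Lemma orient_bary a b c (p q r : R * R * R) :
  p.1.1 + p.1.2 + p.2 = 1 -> q.1.1 + q.1.2 + q.2 = 1 -> r.1.1 + r.1.2 + r.2 = 1 ->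
  orient (bary a b c p) (bary a b c q) (bary a b c r) = det3 p q r * orient a b c.
Proof.
case: p q r => [[p1 p2] p3] [[q1 q2] q3] [[r1 r2] r3] /= ep eq er.
have -> : p1 = 1 - p2 - p3 by rewrite -ep; ring.
have -> : q1 = 1 - q2 - q3 by rewrite -eq; ring.
have -> : r1 = 1 - r2 - r3 by rewrite -er; ring.
by rewrite /orient /bary /= !mxE; ring.
Qed.

Lemma sbetween_extend x p y : sbetween x p y ->
  exists2 k : R, 0 < k & x = (1 + k) *: p - k *: y.
Proof.
move=> [t /andP[t0 t1] ->]; have t1' : 1 - t != 0 by rewrite subr_eq0 gt_eqF.
exists (t / (1 - t)); first by rewrite divr_gt0 ?subr_gt0.
by apply: rv2P; rewrite !mxE; field.
Qed.

(** Reduces every orientation among the six points to the integer table, up to the global sign of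
    the inner triangle. *)
Lemma pinwheel_sgz (a b c a' b' c' : V) (i j k : nat) :
  sbetween a a' c' -> sbetween b b' a' -> sbetween c c' b' ->
  let s := [:: a; b; c; a'; b'; c'] in (i < 6)%N -> (j < 6)%N -> (k < 6)%N ->
  sgz (orient s`_i s`_j s`_k) = pinwheel_sign i j k * sgz (orient a' b' c').
Proof.
move=> /sbetween_extend[x x0 aE] /sbetween_extend[y y0 bE] /sbetween_extend[z z0 cE].
move=> s i6 j6 k6; pose q := pinwheel_coord x y z.
have q1 n : (q n).1.1 + (q n).1.2 + (q n).2 = 1.
  by case: n => [|[|[|[|[|n]]]]] /=; ring.
have sE n : (n < 6)%N -> s`_n = bary a' b' c' (q n).
  case: n => [|[|[|[|[|[|//]]]]]] _; rewrite /s /bary /= ?aE ?bE ?cE;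
  by apply: rv2P; rewrite !mxE; ring.
by rewrite !sE// orient_bary// sgzM (pinwheel_det3_sign x0 y0 z0).
Qed.

(** If [z] is off the line [x y] and [p] is on it, strictly between [z] and [w], then [z] and [w]
    are strictly separated. If [x] were on the line [z w], then so would be [y], and both lines
    would coincide. *)
Lemma complete_strict P :
  (forall x y z w p, P x -> P y -> P z -> P w ->
     orient x y z * orient x y w < 0 -> orient z w x * orient z w y < 0 ->
     sbetween x p y -> sbetween z p w -> P p) -> complete P.
Proof.
have opp (a b t : R) : 0 < t < 1 -> 0 = (1 - t) * a + t * b -> a != 0 -> a * b < 0.
  move=> /andP[t0 t1] e a0; rewrite -(pmulr_rlt0 _ t0) mulrCA.
  rewrite (_ : t * b = - ((1 - t) * a)); last by rewrite -[RHS]addr0 [X in _ + X]e; ring.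
  by rewrite mulrN oppr_lt0 mulrCA mulr_gt0 ?subr_gt0 ?mulrr_gt0_neq0.
move=> H x y z w p Px Py Pz Pw o0 xpy zpw; apply: (H x y z w) => //.
  have [t t01] := sbetween_orient x y zpw; rewrite sbetween_online// => e.
  exact: opp e o0.
have [t t01] := sbetween_orient z w xpy; rewrite sbetween_online// => e.
apply: (opp _ _ _ t01 e); apply: contra_neq o0 => o0.
have [zw|zw] := eqVneq z w.
  move: zpw => [r _]; rewrite zw -scalerDl subrK scale1r => <-.
  exact: sbetween_online.
have oy : orient z w y = 0.
  move: e; rewrite o0 mulr0 add0r => /esym/eqP.
  by rewrite mulf_eq0 gt_eqF ?(andP t01).1//= => /eqP.
have [xy|xy] := eqVneq x y; first by rewrite xy orient_xxy.
by have [k _ ->] := orient_sub_line zw xy o0 oy; rewrite orient_xyx mulr0.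
Qed.

Lemma mem_seq_nth (s : seq V) x : x \in s -> exists2 i, (i < size s)%N & x = s`_i.
Proof. by move=> xs; exists (index x s); rewrite ?index_mem// nth_index. Qed.

(** Holds vacuously: by the table, no two segments between the six points cross properly. *)
Lemma pinwheel_complete P : pinwheel P -> complete P.
Proof.
move=> [a [b [c [a' [b' [c' [D0 h1 h2 h3 ->]]]]]]]; apply: complete_strict.
move=> x y z w p /= /mem_seq_nth[i i6 ->] /mem_seq_nth[j j6 ->].
move=> /mem_seq_nth[k k6 ->] /mem_seq_nth[l l6 ->] o1 o2 _ _; exfalso.
have sgD : sgz (orient a' b' c') * sgz (orient a' b' c') = 1 by case: sgzP D0.
have := pinwheel_no_crossing i6 j6 k6 l6; rewrite /pinwheel_crossing => /negP; apply.
have sg_opp i' j' k' l' : (i' < 6)%N -> (j' < 6)%N -> (k' < 6)%N -> (l' < 6)%N ->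
    let s := [:: a; b; c; a'; b'; c'] in
    orient s`_i' s`_j' s`_k' * orient s`_i' s`_j' s`_l' < 0 ->
    pinwheel_sign i' j' k' * pinwheel_sign i' j' l' == -1.
  move=> i6' j6' k6' l6' s /ltr0_sgz; rewrite sgzM !pinwheel_sgz// mulrACA sgD mulr1.
  by move=> ->.
by rewrite !sg_opp.
Qed.

(** The segment from [v] to the interior point [p] cannot enter through the interior of an edge,
    where the crossing would be a further point of [P], so it enters through a vertex. The
    conclusion selects this vertex by the position of [v] alone, so that it is the same for all
    [p]. *)
Lemma outside_triangle P a b c v p : complete P ->
  P a -> P b -> P c -> P v -> P p ->
  (forall q, P q -> [/\ orient a b q = 0 -> [\/ q = a, q = b | q = v],
     orient b c q = 0 -> [\/ q = b, q = c | q = v] &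
     orient c a q = 0 -> [\/ q = c, q = a | q = v]]) ->
  0 < orient a b c -> orient a b v < 0 ->
  0 < orient b c p -> 0 < orient c a p -> 0 < orient a b p ->
  if orient c a v < 0 then orient v p a = 0 else orient v p b = 0.
Proof.
move=> cP Pa Pb Pc Pv Pp edge D0 G0 p1 p2 p3.
have edge_side x y z : P x -> P y -> orient x y v < 0 -> 0 < orient x y p ->
    (forall q, P q -> orient x y q = 0 -> [\/ q = x, q = y | q = v]) ->
    0 <= orient v p x * orient v p y.
  move=> Px Py v0 p0 e; rewrite leNgt; apply/negP => o.
  have o' : orient x y v * orient x y p < 0 by rewrite nmulr_rlt0.
  have [q [Pq xqy vqp]] := complete_crossing cP Px Py Pv Pp o' o.
  have vpq := sbetween_online vqp.
  case: (e q Pq (sbetween_online xqy)) => qE; move: o; rewrite -?qE ?vpq ?mul0r ?mulr0 ?ltxx//.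
  by move: v0; rewrite -qE sbetween_online// ltxx.
(* These relations tell on which side of the line [v p] a vertex lies from the sides of the edges on
   which [v] and [p] lie. *)
have Ea : orient a b c * orient v p a = orient c a v * orient a b p - orient a b v * orient c a p.
  by rewrite /orient; ring.
have Eb : orient a b c * orient v p b = orient a b v * orient b c p - orient b c v * orient a b p.
  by rewrite /orient; ring.
have Ec : orient a b c * orient v p c = orient b c v * orient c a p - orient c a v * orient b c p.
  by rewrite /orient; ring.
have S : orient a b c = orient b c v + orient c a v + orient a b v by rewrite /orient; ring.
have ab : 0 <= orient v p a * orient v p b.
  by apply: edge_side => // q /edge[].
case: ifPn => [B0|]; last rewrite -leNgt => B0.
- have A0 : 0 < orient b c v by lra.
  have b0 : orient v p b < 0.
    rewrite -(pmulr_rlt0 _ D0) Eb subr_lt0; apply: (@lt_trans _ _ 0); first by rewrite nmulr_rlt0.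
    exact: mulr_gt0.
  have c0 : 0 < orient v p c.
    rewrite -(pmulr_rgt0 _ D0) Ec subr_gt0; apply: (@lt_trans _ _ 0); first by rewrite nmulr_rlt0.
    exact: mulr_gt0.
  have ca : 0 <= orient v p c * orient v p a by apply: edge_side => // q /edge[].
  by apply/eqP; rewrite eq_le -(pmulr_rge0 _ c0) ca andbT -(nmulr_lge0 _ b0).
- have a0 : 0 < orient v p a.
    rewrite -(pmulr_rgt0 _ D0) Ea subr_gt0; apply: (@lt_le_trans _ _ 0).
      by rewrite nmulr_rlt0.
    by rewrite mulr_ge0// ltW.
  have b0 : 0 <= orient v p b by rewrite -(pmulr_rge0 _ a0).
  have A0 : orient b c v < 0.
    rewrite ltNge; apply/negP => A0; have : orient a b c * orient v p b < 0.
      rewrite Eb subr_lt0; apply: (@lt_le_trans _ _ 0); first by rewrite nmulr_rlt0.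
      by rewrite mulr_ge0// ltW.
    by rewrite pmulr_rlt0// ltNge b0.
  have c0 : orient v p c < 0.
    rewrite -(pmulr_rlt0 _ D0) Ec subr_lt0; apply: (@lt_le_trans _ _ 0).
      by rewrite nmulr_rlt0.
    by rewrite mulr_ge0// ltW.
  have bc : 0 <= orient v p b * orient v p c by apply: edge_side => // q /edge[].
  by apply/eqP; rewrite eq_le b0 andbT -(nmulr_lge0 _ c0).
Qed.

End Pinwheel.

(** * Classification of finite complete sets *)

Section Classification.
Context {R : realType}.
Local Notation V := ('rV[R]_2).
Implicit Types (x y z w u v p s : V) (t : R) (P : set V).

(** The inner points [a'], [b'], [c'] are all interior to the outer triangle, so [outside_triangle]
    puts all three on the line through [v] and one common vertex, although they are not
    collinear. *)
Lemma pinwheel_not_extensible_side P a b c a' b' c' v : complete P ->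
  orient a' b' c' != 0 ->
  sbetween a a' c' -> sbetween b b' a' -> sbetween c c' b' ->
  P v -> {in [:: a; b; c; a'; b'; c'], forall x, P x} ->
  (forall x, P x -> x = v \/ x \in [:: a; b; c; a'; b'; c']) ->
  orient a b c * orient a b v < 0 -> False.
Proof.
move=> cP D0 h1 h2 h3 Pv sP Ps DG; set s := [:: a; b; c; a'; b'; c'] in sP Ps.
have sg l m n := @pinwheel_sgz _ a b c a' b' c' l m n h1 h2 h3.
have Pnth n : (n < 6)%N -> P s`_n by move=> n6; apply: sP; rewrite mem_nth.
have sgD : sgz (orient a' b' c') \is a GRing.unit by case: sgzP D0.
have zero l m n : (l < 6)%N -> (m < 6)%N -> (n < 6)%N ->
    orient s`_l s`_m s`_n = 0 -> pinwheel_sign l m n = 0.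
  move=> l6 m6 n6 /eqP; rewrite -sgz_eq0 sg// => /eqP e.
  by apply: (mulIr sgD); rewrite mul0r.
(* The two labellings allow the outer triangle to be taken positively oriented, with [v] still
   beyond its edge [a b]. *)
have core i j k : (i, j, k) \in [:: (0, 1, 2); (1, 0, 2)]%N ->
    0 < orient s`_i s`_j s`_k -> orient s`_i s`_j v < 0 -> False.
  move=> ijk D G.
  have [i6 j6 k6] : [/\ i < 6, j < 6 & k < 6]%N.
    by move: ijk; rewrite !inE => /orP[]/eqP[iE jE kE]; subst i j k.
  have pos l m n : (l < 6)%N -> (m < 6)%N -> (n < 6)%N ->
      pinwheel_sign l m n = pinwheel_sign i j k -> 0 < orient s`_l s`_m s`_n.
    by move=> l6 m6 n6 e; rewrite -sgz_gt0 sg// e -sg// sgz_gt0.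
  have inner n : n \in [:: 3; 4; 5]%N -> if orient s`_k s`_i v < 0
      then orient v s`_n s`_i = 0 else orient v s`_n s`_j = 0.
    move=> n345; have n6 : (n < 6)%N by move: n345; rewrite !inE => /or3P[]/eqP->.
    apply: (@outside_triangle _ P s`_i s`_j s`_k v s`_n) => //; try exact: Pnth.
    - move=> q /Ps[->|/mem_seq_nth[m m6 ->]]; first by split=> _; exact: Or33.
      have H l l' : (l < 6)%N -> (l' < 6)%N ->
          (pinwheel_sign l l' m = 0 -> m = l \/ m = l') ->
          orient s`_l s`_l' s`_m = 0 -> [\/ s`_m = s`_l, s`_m = s`_l' | s`_m = v].
        move=> l6 l'6 imp o0; have [|->|->] := imp; first exact: zero.
        - exact: Or31.
        - exact: Or32.
      split; apply: H => //; move: ijk; rewrite !inE => /orP[]/eqP[iE jE kE]; subst i j k;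
      by case: m m6 => [|[|[|[|[|[|//]]]]]] _; vm_compute; auto.
    - apply: pos => //; move: ijk n345; rewrite !inE.
      by move=> /orP[]/eqP[iE jE kE] /or3P[]/eqP->; subst i j k; vm_compute.
    - apply: pos => //; move: ijk n345; rewrite !inE.
      by move=> /orP[]/eqP[iE jE kE] /or3P[]/eqP->; subst i j k; vm_compute.
    - apply: pos => //; move: ijk n345; rewrite !inE.
      by move=> /orP[]/eqP[iE jE kE] /or3P[]/eqP->; subst i j k; vm_compute.
  have [e [ve eline]] : exists e, v != e /\
      forall n, n \in [:: 3; 4; 5]%N -> orient v e s`_n = 0.
    have [B|B] := boolP (orient s`_k s`_i v < 0).
      exists s`_i; split; first by apply/eqP => e; rewrite e orient_xyx ltxx in G.
      by move=> n /inner; rewrite B => h; rewrite orientC h oppr0.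
    exists s`_j; split; first by apply/eqP => e; rewrite e orient_xyy ltxx in G.
    by move=> n /inner; rewrite (negPf B) => h; rewrite orientC h oppr0.
  have ab : a' != b' by apply: contra_neq D0 => ->; rewrite orient_xxy.
  have [l _ lE] := orient_sub_line ve ab (eline 3 isT) (eline 4 isT).
  by move: D0; rewrite lE (eline 5 isT) mulr0 eqxx.
have [D|D|D] := ltgtP (orient a b c) 0.
- have sw q : orient b a q = - orient a b q by rewrite /orient; ring.
  apply: (core 1 0 2)%N => //=; rewrite sw ?oppr_gt0 ?oppr_lt0//.
  by move: DG; rewrite nmulr_rlt0.
- by apply: (core 0 1 2)%N => //=; move: DG; rewrite pmulr_rlt0.
- by rewrite D mul0r ltxx in DG.
Qed.

(** A pinwheel is invariant under cyclic relabelling, so one edge gives all three. Together the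
    inequalities put [v] in the closed outer triangle. *)
Lemma pinwheel_not_extensible P a b c a' b' c' v : complete P ->
  orient a' b' c' != 0 ->
  sbetween a a' c' -> sbetween b b' a' -> sbetween c c' b' ->
  P v -> {in [:: a; b; c; a'; b'; c'], forall x, P x} ->
  (forall x, P x -> x = v \/ x \in [:: a; b; c; a'; b'; c']) ->
  [/\ 0 <= orient a b c * orient a b v, 0 <= orient a b c * orient b c v
    & 0 <= orient a b c * orient c a v].
Proof.
move=> cP D0 h1 h2 h3 Pv sP Ps.
have perm x y z x' y' z' q : q \in [:: x; y; z; x'; y'; z'] ->
    q \in [:: y; z; x; y'; z'; x'].
  by rewrite !inE => /or4P[|||/or3P[]] ->; rewrite ?orbT.
have perm2 x y z x' y' z' q : q \in [:: x; y; z; x'; y'; z'] ->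
    q \in [:: z; x; y; z'; x'; y'] by move=> /perm/perm.
split; rewrite leNgt; apply/negP => o.
- exact: (pinwheel_not_extensible_side cP D0 h1 h2 h3 Pv).
- apply: (@pinwheel_not_extensible_side P b c a b' c' a' v) => //.
  + by rewrite orient_cycle.
  + by move=> q /perm2 /sP.
  + by move=> q /Ps[->|/perm]; auto.
  + by rewrite orient_cycle.
- apply: (@pinwheel_not_extensible_side P c a b c' a' b' v) => //.
  + by rewrite -orient_cycle.
  + by move=> q /perm /sP.
  + by move=> q /Ps[->|/perm2]; auto.
  + by rewrite -orient_cycle.
Qed.

(* The farthest point from the origin is extreme:
   the weighted mean of |x - v|^2 is that of |x|^2 minus |v|^2. *)
Lemma farthest_extreme a b c v (r1 r2 r3 : R) :
  0 <= r1 -> 0 <= r2 -> 0 <= r3 -> r1 + r2 + r3 = 1 ->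
  v = r1 *: a + r2 *: b + r3 *: c ->
  sqdist a 0 <= sqdist v 0 -> sqdist b 0 <= sqdist v 0 -> sqdist c 0 <= sqdist v 0 ->
  [\/ a = v, b = v | c = v].
Proof.
move=> r10 r20 r30 r1E vE qa qb qc.
have e : r1 * sqdist a v + r2 * sqdist b v + r3 * sqdist c v =
         r1 * (sqdist a 0 - sqdist v 0) + r2 * (sqdist b 0 - sqdist v 0)
         + r3 * (sqdist c 0 - sqdist v 0).
  have -> : r1 = 1 - r2 - r3 by rewrite -r1E; ring.
  rewrite vE (_ : r1 = 1 - r2 - r3); last by rewrite -r1E; ring.
  by rewrite /sqdist !mxE; ring.
have le0 (r q : R) : 0 <= r -> q <= sqdist v 0 -> r * (q - sqdist v 0) <= 0.
  by move=> r0 qv; rewrite mulr_ge0_le0// subr_le0.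
have a0 := mulr_ge0 r10 (sqdist_ge0 a v).
have b0 := mulr_ge0 r20 (sqdist_ge0 b v).
have c0 := mulr_ge0 r30 (sqdist_ge0 c v).
have la := le0 _ _ r10 qa; have lb := le0 _ _ r20 qb; have lc := le0 _ _ r30 qc.
have zero (r : R) q : r * sqdist q v = 0 -> r != 0 -> q = v.
  by move=> /eqP; rewrite mulf_eq0 sqdist_eq0 => /orP[->//|/eqP].
have [r1z|r1n] := eqVneq r1 0; last by apply: Or31; apply: zero r1n; lra.
have [r2z|r2n] := eqVneq r2 0; last by apply: Or32; apply: zero r2n; lra.
by apply: Or33; apply: (zero r3); lra.
Qed.

Lemma farthest_exists (s : seq V) : s != [::] ->
  exists2 v, v \in s & {in s, forall x, sqdist x 0 <= sqdist v 0}.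
Proof.
elim: s => // x [|y s] IH _.
  by exists x; rewrite ?mem_head// => z; rewrite inE => /eqP->.
have [//|v vs vmax] := IH.
have [xv|vx] := leP (sqdist x 0) (sqdist v 0).
  exists v; first by rewrite inE vs orbT.
  by move=> z; rewrite inE => /predU1P[->//|/vmax].
exists x; first exact: mem_head.
by move=> z; rewrite inE => /predU1P[->//|/vmax zv]; apply: le_trans zv (ltW vx).
Qed.

Lemma line_plus_two_axial P u w s v : complete P -> u != w ->
  (forall p, P p -> [\/ orient u w p = 0, p = s | p = v]) -> axial P.
Proof.
move=> cP uw offP.
have [sv|sv] := leP (orient u w s * orient u w v) 0; first by exists u, w, s, v.
have [Ps|nPs] := pselect (P s); last first.
  exists u, w, u, v; split=> //; last by rewrite orient_xyx mul0r.
  by move=> x Px; case: (offP x Px) => [|e|]; [exact: Or31|subst|exact: Or33].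
have [Pv|nPv] := pselect (P v); last first.
  exists u, w, s, u; split=> //; last by rewrite orient_xyx mulr0.
  by move=> x Px; case: (offP x Px) => [||e]; [exact: Or31|exact: Or32|subst].
exact: (two_same_side_axial cP uw Ps Pv sv).
Qed.

Lemma line_plus_three P u w s v s' : complete P -> u != w ->
  P s -> P v -> P s' -> 0 < orient u w s * orient u w v ->
  orient u w s * orient u w s' < 0 ->
  (forall p, P p -> [\/ orient u w p = 0, p = s, p = v | p = s']) ->
  axial P \/ pinwheel P.
Proof.
move=> cP uw Ps Pv Ps' sv ss' offP.
have [s0|s0|s0] := ltgtP (orient u w s) 0; last by rewrite s0 mul0r ltxx in sv.
- have sw q : orient w u q = - orient u w q by rewrite /orient; ring.
  apply: (@two_plus_one _ P w u s v s') => //; rewrite ?sw ?oppr_gt0 ?oppr_lt0//.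
  + by rewrite eq_sym.
  + by move: sv; rewrite nmulr_rgt0.
  + by move: ss'; rewrite nmulr_rlt0.
  + by move=> p /offP; rewrite sw => -[->|||]; rewrite ?oppr0;
      [exact: Or41|exact: Or42|exact: Or43|exact: Or44].
- apply: (@two_plus_one _ P u w s v s') => //.
  + by move: sv; rewrite pmulr_rgt0.
  + by move: ss'; rewrite pmulr_rlt0.
Qed.

(** If [s], [s'] and [v] are all in [P] and off the axis, then [s] and [s'] are strictly separated
    and [v] joins one of them on its side: two points against one. *)
Lemma axial_extend P u w s s' v : complete P -> u != w -> P v ->
  (forall p, P p -> p != v -> [\/ orient u w p = 0, p = s | p = s']) ->
  orient u w s * orient u w s' <= 0 -> axial P \/ pinwheel P.
Proof.
move=> cP uw Pv offP ss'.
have offP' p : P p -> [\/ orient u w p = 0, p = s, p = v | p = s'].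
  move=> Pp; have [->|pv] := eqVneq p v; first exact: Or43.
  by case: (offP p Pp pv); [exact: Or41|exact: Or42|exact: Or44].
have [[Ps s0]|ns] := pselect (P s /\ orient u w s != 0); last first.
  left; apply: (@line_plus_two_axial P u w s' v) => // p Pp.
  case: (offP' p Pp) => [|pE||]; [exact: Or31| |exact: Or33|exact: Or32].
  apply: Or31; apply/eqP; apply: contraT => p0; case: ns; rewrite -pE; split=> //.
have [[Ps' s'0]|ns'] := pselect (P s' /\ orient u w s' != 0); last first.
  left; apply: (@line_plus_two_axial P u w s v) => // p Pp.
  case: (offP' p Pp) => [|||pE]; [exact: Or31|exact: Or32|exact: Or33|].
  apply: Or31; apply/eqP; apply: contraT => p0; case: ns'; rewrite -pE; split=> //.
have [v0|v0] := eqVneq (orient u w v) 0.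
  left; exists u, w, s, s'; split=> // p /offP'[||->|];
    [exact: Or31|exact: Or32|exact: Or31|exact: Or33].
have {}ss' : orient u w s * orient u w s' < 0 by rewrite lt_neqAle mulf_neq0.
have [sv|sv|/eqP] := ltgtP (orient u w s * orient u w v) 0; last 2 first.
- exact: (@line_plus_three P u w s v s').
- by rewrite mulf_eq0 (negPf s0) (negPf v0).
apply: (@line_plus_three P u w s' v s) => //.
- apply: (@same_sign_trans _ _ (- orient u w s)).
    by rewrite mulrN oppr_gt0 mulrC.
  by rewrite mulNr oppr_gt0.
- by rewrite mulrC.
- move=> p /offP'[]; [exact: Or41|exact: Or44|exact: Or43|exact: Or42].
Qed.

Theorem complete_classification (s : seq V) : complete [set` s] ->
  axial [set` s] \/ pinwheel [set` s].
Proof.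
have [n] := ubnP (size s); elim: n s => // n IH s sn cs.
have [s0|s0] := eqVneq s [::].
  left; exists 0, (const_mx 1), 0, 0; split=> //; last by rewrite orient_xyx mul0r.
    apply/eqP => /rowP/(_ 0); rewrite !mxE => /eqP.
    by rewrite eq_sym oner_eq0.
  by move=> x; rewrite s0.
have [v vs vmax] := farthest_exists s0.
pose s' := [seq x <- s | x != v].
have s's x : x \in s' -> x \in s by rewrite mem_filter => /andP[].
have s'v x : x \in s' -> x != v by rewrite mem_filter => /andP[].
have ss' x : x \in s -> x != v -> x \in s' by move=> xs xv; rewrite mem_filter xv.
(* Stated for triangles to serve both uses: crossings of segments, with third weight 0, and the
   outer triangle of a pinwheel. *)
have hull a b c (r1 r2 r3 : R) : a \in s' -> b \in s' -> c \in s' ->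
    0 <= r1 -> 0 <= r2 -> 0 <= r3 -> r1 + r2 + r3 = 1 ->
    v <> r1 *: a + r2 *: b + r3 *: c.
  move=> a' b' c' r10 r20 r30 r1E vE.
  have [] := farthest_extreme r10 r20 r30 r1E vE; try by apply: vmax; apply: s's.
  - by move=> av; move: (s'v a a'); rewrite av eqxx.
  - by move=> av; move: (s'v b b'); rewrite av eqxx.
  - by move=> av; move: (s'v c c'); rewrite av eqxx.
have size_s' : (size s' < n)%N.
  rewrite -ltnS (leq_ltn_trans _ sn)// size_filter -(count_predC (pred1 v) s).
  rewrite -[X in (X < _)%N]add0n.
  by rewrite ltn_add2r -has_count has_pred1.
have cs' : complete [set` s'].
  move=> x y z w p /= xs ys zs ws o0 xpy zpw.
  apply: ss'; first by apply: (cs x y z w) => //=; apply: s's.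
  apply/eqP => pv; move: xpy => [t /andP[t0 t1] pE].
  apply: (hull x y y (1 - t) t 0) => //; rewrite ?subr_ge0 ?ltW//; first by ring.
  by rewrite scale0r addr0 -pv.
have [[u [w [x [y [uw offP xy]]]]]|] := IH s' size_s' cs'.
  by apply: (@axial_extend _ u w x y v) => // p /= ps pv; apply: offP; apply: ss'.
move=> [a [b [c [a' [b' [c' [D0 h1 h2 h3 E]]]]]]]; exfalso.
have mE x : (x \in s') = (x \in [:: a; b; c; a'; b'; c']).
  have /= e : [set` s'] x = [set` [:: a; b; c; a'; b'; c']] x by rewrite E.
  by apply/idP/idP => h; [rewrite -e|rewrite e].
have [||G A B] := pinwheel_not_extensible cs D0 h1 h2 h3 vs.
- by move=> x; rewrite -mE => /s's.
- by move=> x /= xs; have [->|xv] := eqVneq x v; [left|right; rewrite -mE; apply: ss'].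
set D := orient a b c in G A B.
have Dn0 : D != 0.
  rewrite -sgz_eq0 (@pinwheel_sgz _ a b c a' b' c' 0 1 2)//.
  by rewrite mulf_neq0// sgz_eq0.
have DD := mulrr_gt0_neq0 Dn0.
have [as' bs' cs''] : [/\ a \in s', b \in s' & c \in s'].
  by rewrite !mE !inE !eqxx !orbT.
(* The weights are the barycentric coordinates of [v]. The extra factor [D] makes their signs
   visible for either orientation of the triangle. *)
apply: (hull a b c ((D * orient b c v) / (D * D)) ((D * orient c a v) / (D * D))
  ((D * orient a b v) / (D * D))) => //.
- by rewrite divr_ge0// ltW.
- by rewrite divr_ge0// ltW.
- by rewrite divr_ge0// ltW.
- have S : D = orient b c v + orient c a v + orient a b v by rewrite /D /orient; ring.
  by rewrite -!mulrDl -!mulrDr -S divff// gt_eqF.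
- rewrite -!mulf_div !divff// !mul1r; apply: rv2P; rewrite !mxE;
  by move: Dn0; rewrite /D /orient => Dn0; field.
Qed.

End Classification.

(** * Convex hulls and basic solutions *)

Section ConvexHull.
Context {R : realType} {d : nat}.
Local Notation V := ('rV[R]_d).
Implicit Types (x y : V) (t : R) (A C : set V).

Lemma convex_setP C : @convex_set R V C <->
  forall x y t, C x -> C y -> 0 <= t <= 1 -> C ((1 - t) *: x + t *: y).
Proof.
split=> [cC x y t Cx Cy t01|H x y l /set_mem Cx /set_mem Cy].
  have t01' : 0 <= 1 - t <= 1 by lra.
  have := cC x y (Itv01 (andP t01').1 (andP t01').2) (mem_set Cx) (mem_set Cy).
  by move/set_mem; rewrite /conv /= /unstable.onem subKr.
apply/mem_set; have := H x y (1 - l%:num) Cx Cy.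
by rewrite /conv /= subKr; apply; rewrite subr_ge0 le1 lerBlDl lerDr ge0.
Qed.

Lemma ch_convex A : @convex_set R V (ch A).
Proof.
apply/convex_setP => x y t Ax Ay t01 C [cC AC].
by move/convex_setP: (cC); apply => //; [apply: Ax|apply: Ay].
Qed.

Lemma sub_ch A : A `<=` ch A.
Proof. exact: sub_gen_smallest. Qed.

Lemma ch_min A C : @convex_set R V C -> A `<=` C -> ch A `<=` C.
Proof. exact: smallest_sub. Qed.

Lemma ch_mono A C : A `<=` C -> ch A `<=` ch C.
Proof. by move=> AC; apply: ch_min; [exact: ch_convex|move=> z /AC /sub_ch]. Qed.

Lemma ch_set1 x : ch [set x] = [set x].
Proof.
apply: smallest_id; apply/convex_setP => a b t -> -> _ /=.
by rewrite -scalerDl subrK scale1r.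
Qed.

Lemma ch_setU A C : ch (ch A `|` ch C) = ch (A `|` C).
Proof.
apply/seteqP; split.
  apply: ch_min; first exact: ch_convex.
  by move=> x [|]; apply: ch_mono => z; [left|right].
by apply: ch_mono => x [|] /sub_ch; [left|right].
Qed.

(** Normalized by the total weight because the weights of a tail no longer sum to one in the
    induction. *)
Lemma convex_comb_seq (I : eqType) (C : set V) (r : seq I) (a : I -> R) (y : I -> V) :
  @convex_set R V C -> (forall i, 0 <= a i) -> (forall i, a i != 0 -> C (y i)) ->
  0 < \sum_(i <- r) a i ->
  C ((\sum_(i <- r) a i)^-1 *: \sum_(i <- r) a i *: y i).
Proof.
move=> /convex_setP cC a0 aC; elim: r => [|j r IH]; first by rewrite big_nil ltxx.
rewrite !big_cons; set s := \sum_(i <- r) a i; set p := \sum_(i <- r) a i *: y i => s0.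
have sge0 : 0 <= s by rewrite sumr_ge0.
have [sz|sn] := eqVneq s 0.
  have -> : p = 0.
    rewrite /p big_seq big1// => i ir; suff -> : a i = 0 by rewrite scale0r.
    move/eqP: sz; rewrite psumr_eq0; last by move=> k _; apply: a0.
    by move=> /allP/(_ _ ir)/eqP.
  move: s0; rewrite sz !addr0 => aj0; rewrite scalerA mulVf ?gt_eqF// scale1r.
  by apply: aC; rewrite gt_eqF.
have spos : 0 < s by rewrite lt_neqAle eq_sym sn.
have Cp := IH spos; rewrite -/s -/p in Cp.
have [az|an] := eqVneq (a j) 0; first by rewrite az scale0r !add0r.
have := cC _ _ (s / (a j + s)) (aC _ an) Cp; rewrite scalerA.
rewrite mulrAC divff// mul1r scalerDr scalerA.
rewrite (_ : 1 - s / (a j + s) = (a j + s)^-1 * a j); last first.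
  by field; rewrite gt_eqF.
by apply; rewrite divr_ge0 ?(ltW s0)//= ler_pdivrMr// mul1r lerDr.
Qed.

Lemma convex_comb (I : finType) (C : set V) (a : I -> R) (y : I -> V) :
  @convex_set R V C -> (forall i, 0 <= a i) -> \sum_i a i = 1 ->
  (forall i, a i != 0 -> C (y i)) -> C (\sum_i a i *: y i).
Proof.
move=> cC a0 a1 aC; have := @convex_comb_seq _ C (index_enum I) a y cC a0 aC.
by rewrite a1 invr1 scale1r; apply.
Qed.

Lemma ch_comb (I : finType) (y : I -> V) (A : {pred I}) p :
  ch [set y i | i in [set i | i \in A]] p ->
  exists a : I -> R, [/\ forall i, 0 <= a i, forall i, i \notin A -> a i = 0,
    \sum_i a i = 1 & p = \sum_i a i *: y i].
Proof.
pose C := [set p : V | exists a : I -> R, [/\ forall i, 0 <= a i,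
  forall i, i \notin A -> a i = 0, \sum_i a i = 1 & p = \sum_i a i *: y i]].
apply: (@ch_min _ C).
  apply/convex_setP => _ _ t [a [a0 aA a1 ->]] [b [b0 bA b1 ->]] /andP[t0 t1].
  exists (fun i => (1 - t) * a i + t * b i); split.
  - by move=> i; rewrite addr_ge0// mulr_ge0// subr_ge0.
  - by move=> i iA; rewrite aA// bA// !mulr0 addr0.
  - by rewrite big_split/= -!mulr_sumr a1 b1; ring.
  - by rewrite !scaler_sumr -big_split/=; apply: eq_bigr => i _; rewrite !scalerA -scalerDl.
move=> _ [i iA <-]; exists (fun k => (k == i)%:R); split.
- by move=> k; rewrite ler0n.
- by move=> k kA; case: eqP => // ki; rewrite ki iA in kA.
- by rewrite (bigD1 i)//= eqxx big1 ?addr0// => k /negPf->.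
- by rewrite (bigD1 i)//= eqxx scale1r big1 ?addr0// => k /negPf->; rewrite scale0r.
Qed.

End ConvexHull.

(** * Basic solutions of linear systems with nonnegative unknowns *)

Section BasicSolutions.
Context {R : realType} {I : finType} {m d : nat}.
Variables (M : I -> 'rV[R]_m) (b : 'rV[R]_m).
Implicit Types (a e : I -> R).

Definition feasible a : Prop := (forall i, 0 <= a i) /\ \sum_i a i *: M i = b.

(** As in linear programming: the columns [M i] in the support of [a] are linearly independent. *)
Definition basic a : Prop := forall e, (forall i, a i = 0 -> e i = 0) ->
  \sum_i e i *: M i = 0 -> forall i, e i = 0.

Lemma basic_card a : basic a -> (#|[pred i | a i != 0%R]| <= m)%N.
Proof.
move=> ba; rewrite leqNgt; apply/negP; set S := [pred i | _] => mS.
pose A := \matrix_(k < #|S|) M (enum_val k).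
(* More than [m] rows of length [m] are dependent. A kernel vector, extended by zero off the
   support, contradicts [ba]. *)
have : kermx A != 0.
  by rewrite kermx_eq0 -row_leq_rank -ltnNge (leq_ltn_trans (rank_leq_col A) mS).
move/rowV0Pn => [v /sub_kermxP vA vn0]; move/eqP: vn0; apply.
pose e i := \sum_k v 0 k * (enum_val k == i)%:R.
have eE k : e (enum_val k) = v 0 k.
  rewrite /e (bigD1 k)//= eqxx mulr1 big1 ?addr0// => l lk.
  by rewrite (inj_eq enum_val_inj) (negPf lk) mulr0.
have e0 i : a i = 0 -> e i = 0.
  move=> ai; rewrite /e big1// => k _; case: eqP => [ki|]; last by rewrite mulr0.
  by have := enum_valP k; rewrite ki inE ai eqxx.
apply/rowP => k; rewrite mxE -eE; apply: ba => //.
rewrite (bigID (mem S))/= [X in _ + X]big1 ?addr0; last first.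
  by move=> i; rewrite inE negbK => /eqP/e0->; rewrite scale0r.
rewrite big_enum_val -[RHS]vA mulmx_sum_row; apply: eq_bigr => l _.
by rewrite eE rowK.
Qed.

(** The ratio test of the simplex method: [t] is the largest step along [e] that keeps all weights
    nonnegative. *)
Lemma shrink_support a e j : (forall i, 0 <= a i) -> (forall i, a i = 0 -> e i = 0) ->
  e j < 0 -> exists t, [/\ 0 < t, forall i, 0 <= a i + t * e i
    & exists2 k, a k != 0 & a k + t * e k = 0].
Proof.
move=> a0 ae ej; pose k := [arg min_(i < j | e i < 0) (a i / - e i)]%O.
have [ek kmin] : e k < 0 /\ forall i, e i < 0 -> a k / - e k <= a i / - e i.
  by rewrite /k; case: arg_minP.
have ak : a k != 0 by apply/eqP => /ae ek0; rewrite ek0 ltxx in ek.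
exists (a k / - e k); split.
- by rewrite divr_gt0 ?oppr_gt0// lt_neqAle eq_sym ak a0.
- move=> i; have [ei|ei] := ltP (e i) 0.
    by have := kmin i ei; rewrite ler_pdivlMr ?oppr_gt0// mulrN -subr_ge0 opprK.
  by rewrite addr_ge0// mulr_ge0// divr_ge0// oppr_ge0 ltW.
- by exists k => //; rewrite invrN mulrN mulNr divfK ?subrr// lt_eqF.
Qed.

(* A feasible solution which is not basic lies between two feasible solutions of
   smaller support. *)
Lemma basic_induction (C : set 'rV[R]_d) (y : I -> 'rV[R]_d) (D : {pred I}) :
  @convex_set R _ C ->
  (forall e, \sum_i e i *: M i = 0 -> (exists i, e i != 0) -> exists i, e i < 0) ->
  (forall a, feasible a -> (forall i, i \notin D -> a i = 0) -> basic a ->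
     C (\sum_i a i *: y i)) ->
  forall a, feasible a -> (forall i, i \notin D -> a i = 0) -> C (\sum_i a i *: y i).
Proof.
move=> /convex_setP cC bnd base a.
have [n] := ubnP #|[pred i | a i != 0]|; elim: n a => // n IH a an [a0 aM] aD.
have [|nb] := pselect (basic a); first exact: base.
have [e [ea eM [i ei]]] : exists e, [/\ forall i, a i = 0 -> e i = 0,
    \sum_i e i *: M i = 0 & exists i, e i != 0].
  apply: contrapT => ne; apply: nb => e ea eM i; apply/eqP; apply: contraT => ei.
  by case: ne; exists e; split=> //; exists i.
(* By [bnd] every nonzero kernel direction has a negative entry, so both [e] and [- e] reach the
   boundary, after steps [t] and [r]. The weight [t / (t + r)] then balances the two
   displacements. *)
have step e' : (forall i, a i = 0 -> e' i = 0) -> \sum_i e' i *: M i = 0 ->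
    (exists i, e' i != 0) ->
    exists2 t, 0 < t & C (\sum_i (a i + t * e' i) *: y i).
  move=> ea' eM' en'; have [j ej] := bnd e' eM' en'.
  have [t [t0 ge0 [k ak kz]]] := shrink_support a0 ea' ej.
  exists t => //; apply: IH.
  - rewrite ltnS in an; apply: leq_trans an; apply: proper_card; apply/properP; split.
      by apply/fintype.subsetP => l; rewrite !inE; apply: contra_neq => al;
        rewrite al ea'// mulr0 addr0.
    by exists k; rewrite !inE ?ak// kz eqxx.
  - split=> //; under eq_bigr do rewrite scalerDl -scalerA.
    by rewrite big_split/= -scaler_sumr eM' scaler0 addr0.
  - by move=> l /aD al; rewrite al ea'// mulr0 addr0.
have [t t0 Ct] := step e ea eM (ex_intro _ i ei).
have [|||r r0 Cr] := step (fun i => - e i).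
- by move=> l /ea->; rewrite oppr0.
- by under eq_bigr do rewrite scaleNr; rewrite sumrN eM oppr0.
- by exists i; rewrite oppr_eq0.
have tr : 0 < t + r by rewrite addr_gt0.
have := cC _ _ (t / (t + r)) Ct Cr; rewrite !scaler_sumr -big_split/=.
rewrite (eq_bigr (fun i => a i *: y i)); last first.
  move=> l _; rewrite !scalerA -scalerDl; congr (_ *: _); field.
  by rewrite gt_eqF.
by apply; rewrite divr_ge0 ?ltW//= ltr_pdivrMr// mul1r ltrDl.
Qed.

End BasicSolutions.

(** * The lattice of a set closed under crossings *)

Section CompleteLattice.
Context {R : realType} {n : nat}.
Local Notation V := ('rV[R]_2).
Variable y : 'I_n -> V.

Definition hull (A : {pred 'I_n}) : set V := ch [set y i | i in [set i | i \in A]].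

(* A pair of convex combinations of the points y i (weights on the left and
   right summands) representing the same point. *)
Definition pair_system (k : 'I_n + 'I_n) : 'rV[R]_4 :=
  \row_j match k with
         | inl i => [:: 1; 0; y i 0 0; y i 0 1]
         | inr i => [:: 0; 1; - y i 0 0; - y i 0 1]
         end`_j.

Lemma pair_systemE (e : 'I_n + 'I_n -> R) (c1 c2 : R) (v : V) :
  \sum_k e k *: pair_system k = \row_j [:: c1; c2; v 0 0; v 0 1]`_j <->
  [/\ \sum_i e (inl i) = c1, \sum_i e (inr i) = c2 &
    \sum_i e (inl i) *: y i = v + \sum_i e (inr i) *: y i].
Proof.
have sumE (j : 'I_4) : (\sum_k e k *: pair_system k) 0 j =
    \sum_i e (inl i) * [:: 1; 0; y i 0 0; y i 0 1]`_j +
    \sum_i e (inr i) * [:: 0; 1; - y i 0 0; - y i 0 1]`_j.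
  by rewrite summxE big_sumType/=; congr (_ + _); apply: eq_bigr => i _; rewrite !mxE.
have coord (j : 'I_2) (f : 'I_n -> R) :
    (\sum_i f i *: y i) 0 j = \sum_i f i * y i 0 j.
  by rewrite summxE; apply: eq_bigr => i _; rewrite mxE.
split=> [E|[E1 E2 E3]].
  have {}E (j : 'I_4) : \sum_i e (inl i) * [:: 1; 0; y i 0 0; y i 0 1]`_j +
      \sum_i e (inr i) * [:: 0; 1; - y i 0 0; - y i 0 1]`_j =
      [:: c1; c2; v 0 0; v 0 1]`_j by rewrite -sumE E mxE.
  split.
  - have := E (inord 0); rewrite inordK//=; under eq_bigr do rewrite mulr1.
    by under [X in _ + X]eq_bigr do rewrite mulr0; rewrite big1_eq addr0.
  - have := E (inord 1); rewrite inordK//=; under eq_bigr do rewrite mulr0.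
    by under [X in _ + X]eq_bigr do rewrite mulr1; rewrite big1_eq add0r.
  - apply: rv2P; rewrite mxE !coord.
      have := E (inord 2); rewrite inordK//= => <-.
      by under [X in _ + X + _]eq_bigr do rewrite mulrN; rewrite sumrN subrK.
    have := E (inord 3); rewrite inordK//= => <-.
    by under [X in _ + X + _]eq_bigr do rewrite mulrN; rewrite sumrN subrK.
apply/rowP => j; rewrite sumE mxE.
have E0 := congr1 (fun w : V => w 0 0) E3; have E1' := congr1 (fun w : V => w 0 1) E3.
rewrite /= mxE !coord in E0; rewrite /= mxE !coord in E1'.
case: j => [[|[|[|[|//]]]] j4] /=.
- by under eq_bigr do rewrite mulr1; under [X in _ + X]eq_bigr do rewrite mulr0;
    rewrite big1_eq addr0.
- by under eq_bigr do rewrite mulr0; under [X in _ + X]eq_bigr do rewrite mulr1;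
    rewrite big1_eq add0r.
- by under [X in _ + X]eq_bigr do rewrite mulrN; rewrite sumrN E0 addrK.
- by under [X in _ + X]eq_bigr do rewrite mulrN; rewrite sumrN E1' addrK.
Qed.

Lemma pair_system0 (e : 'I_n + 'I_n -> R) :
  \sum_k e k *: pair_system k = 0 <->
  [/\ \sum_i e (inl i) = 0, \sum_i e (inr i) = 0 &
    \sum_i e (inl i) *: y i = \sum_i e (inr i) *: y i].
Proof.
have E0 : \row_(j < 4) [:: 0; 0; (0 : V) 0 0; (0 : V) 0 1]`_j = 0.
  by apply/rowP => j; rewrite !mxE; case: j => [[|[|[|[|//]]]] j4].
have := pair_systemE e 0 0 0.
by rewrite E0 add0r.
Qed.

Lemma sum_single (W : lmodType R) (a : 'I_n -> R) (z : 'I_n -> W) i :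
  (forall j, j != i -> a j = 0) -> \sum_j a j *: z j = a i *: z i.
Proof.
by move=> ai; rewrite (bigD1 i)//= big1 ?addr0// => j /ai ->; rewrite scale0r.
Qed.

Lemma sum_two (W : lmodType R) (a : 'I_n -> R) (z : 'I_n -> W) i j : i != j ->
  (forall k, k != i -> k != j -> a k = 0) ->
  \sum_k a k *: z k = a i *: z i + a j *: z j.
Proof.
move=> ij aij; rewrite (bigD1 i)//= (bigD1 j)/=; last by rewrite eq_sym.
by rewrite big1 ?addr0// => k /andP[ki kj]; rewrite aij// scale0r.
Qed.

(** Makes [sum_single] and [sum_two] applicable to sums of scalars. *)
Lemma sum_regular (a : 'I_n -> R) : \sum_k a k = \sum_k a k *: (1 : R^o).
Proof. by apply: eq_bigr => k _; rewrite /GRing.scale/= mulr1. Qed.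

Lemma singleton_or_pair (a : 'I_n -> R) : \sum_i a i = 1 ->
  (exists2 i, a i = 1 & forall j, j != i -> a j = 0) \/
  (exists i j, [/\ i != j, a i != 0 & a j != 0]).
Proof.
move=> a1; have [i ai] : exists i, a i != 0.
  apply: contrapT => na; move/eqP: a1; rewrite big1 1?eq_sym ?oner_eq0// => i _.
  by apply/eqP; apply: contraT => ai; case: na; exists i.
have [[j [ij aj]]|nj] := pselect (exists j, i != j /\ a j != 0).
  by right; exists i, j.
left; have aj j : j != i -> a j = 0.
  by move=> ji; apply/eqP; apply: contraT => aj; case: nj; exists j; rewrite eq_sym.
exists i => //; move: a1; rewrite sum_regular (sum_single _ aj).
by rewrite /GRing.scale/= mulr1.
Qed.

Lemma sbetween_sum_two (a : 'I_n -> R) i j : (forall k, 0 <= a k) -> \sum_k a k = 1 ->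
  i != j -> a i != 0 -> a j != 0 -> (forall k, k != i -> k != j -> a k = 0) ->
  sbetween (y i) (\sum_k a k *: y k) (y j).
Proof.
move=> a0 a1 ij ai aj aij; rewrite (sum_two _ ij aij).
move: a1; rewrite sum_regular (sum_two _ ij aij) /GRing.scale/= !mulr1 => a1.
have ai0 : 0 < a i by rewrite lt_neqAle eq_sym ai a0.
have aj0 : 0 < a j by rewrite lt_neqAle eq_sym aj a0.
by exists (a j); [lra|rewrite -a1 addrK].
Qed.

Lemma hull_capE (A B : {pred 'I_n}) : complete (range y) ->
  hull A `&` hull B = hull [pred i | `[< hull A (y i) /\ hull B (y i) >]].
Proof.
move=> cP; apply/seteqP; split; last first.
  move=> p Hp; split; move: p Hp; apply: ch_min; try exact: ch_convex.
    by move=> _ [i /asboolP[hA _] <-].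
  by move=> _ [i /asboolP[_ hB] <-].
move=> p [/ch_comb[a1 [a10 a1A a11 pE1]] /ch_comb[a2 [a20 a2B a21 pE2]]].
set C := hull _.
pose b : 'rV[R]_4 := \row_j [:: 1; 1; (0 : V) 0 0; (0 : V) 0 1]`_j.
pose z (k : 'I_n + 'I_n) : V := if k is inl i then y i else 0.
pose D : {pred 'I_n + 'I_n} :=
  fun k => match k with inl i => i \in A | inr i => i \in B end.
have zE (a : 'I_n + 'I_n -> R) : \sum_k a k *: z k = \sum_i a (inl i) *: y i.
  rewrite big_sumType/= [X in _ + X]big1 ?addr0// => i _.
  by rewrite scaler0.
pose a k := match k with inl i => a1 i | inr i => a2 i end.
have -> : p = \sum_k a k *: z k by rewrite zE.
apply: (@basic_induction _ _ _ _ pair_system b C z D) => /=.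
- exact: ch_convex.
(* A kernel direction without negative entries vanishes, since each half of it sums to zero. *)
- move=> e /pair_system0[e1 e2 _] [k ek]; apply: contrapT => ne.
  have e0 l : 0 <= e l by rewrite leNgt; apply/negP => el; apply: ne; exists l.
  case: k ek => i.
    move/eqP: e1; rewrite psumr_eq0// => /allP/(_ i); rewrite mem_index_enum.
    by move=> /(_ isT)/eqP ->; rewrite eqxx.
  move/eqP: e2; rewrite psumr_eq0// => /allP/(_ i); rewrite mem_index_enum.
  by move=> /(_ isT)/eqP ->; rewrite eqxx.
- move=> {a1 a10 a1A a11 pE1 a2 a20 a2B a21 pE2 p} {}a [a0 /pair_systemE[aL aR aE]] aD ba.
  rewrite zE; rewrite add0r in aE.
  have aA i : a (inl i) != 0 -> i \in A by apply: contraR => iA; apply/eqP/aD.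
  have aB i : a (inr i) != 0 -> i \in B by apply: contraR => iB; apply/eqP/aD.
  have hA : hull A (\sum_i a (inl i) *: y i).
    by apply: convex_comb => //; [exact: ch_convex|move=> i /aA iA; apply: sub_ch; exists i].
  have hB : hull B (\sum_i a (inl i) *: y i).
    rewrite aE; apply: convex_comb => //; first exact: ch_convex.
    by move=> i /aB iB; apply: sub_ch; exists i.
  (* A point [y i] lying in both hulls is one of the generators of [C]. *)
  suff [i pE] : exists i, \sum_i a (inl i) *: y i = y i.
    rewrite pE; apply: sub_ch; exists i => //; apply/asboolP.
    by rewrite -pE.
  have [[i ai aj]|[i [j [ij ai aj]]]] := singleton_or_pair aL.
    by exists i; rewrite (sum_single _ aj) ai scale1r.
  have [[k ak al]|[k [l [kl ak al]]]] := singleton_or_pair aR.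
    by exists k; rewrite aE (sum_single _ al) ak scale1r.
  (* Two nonzero weights on each side use up the four that [basic_card] allows, so the point is
     strictly between [y i] and [y j] and between [y k] and [y l]. *)
  have card5 x : a x != 0 -> uniq [:: x; inl i; inl j; inr k; inr l] -> False.
    move=> ax /card_uniqP /= c5; have := basic_card ba.
    rewrite leqNgt => /negP; apply; rewrite -c5; apply: subset_leq_card.
    by apply/fintype.subsetP => w; rewrite !inE => /or4P[|||/orP[]] /eqP->.
  have eqL := inj_eq (@inl_inj 'I_n 'I_n); have eqR := inj_eq (@inr_inj 'I_n 'I_n).
  have ij' s : s != i -> s != j -> a (inl s) = 0.
    move=> si sj; apply/eqP; apply: contraT => /card5; rewrite /= !inE !negb_or.
    by rewrite !eqL !eqR si sj ij kl !andbT /= => -[].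
  have kl' s : s != k -> s != l -> a (inr s) = 0.
    move=> sk sl; apply/eqP; apply: contraT => /card5; rewrite /= !inE !negb_or.
    by rewrite !eqL !eqR sk sl ij kl !andbT /= => -[].
  have sL := sbetween_sum_two (fun k => a0 (inl k)) aL ij ai aj ij'.
  have sR := sbetween_sum_two (fun k => a0 (inr k)) aR kl ak al kl'.
  rewrite -aE in sR; set p := \sum_i _ in sL sR *.
  (* If the four points were on one line, their differences would be parallel, and this would be a
     dependency among columns of a basic solution. *)
  suff o0 : orient (y i) (y j) (y k) != 0.
    have [r _ <-] : range y p by apply: (cP (y i) (y j) (y k) (y l)).
    by exists r.
  apply/eqP => o0.
  have dep c1 c2 : c1 *: (y i - y j) = c2 *: (y k - y l) -> c1 = 0 /\ c2 = 0.
    move=> cE; pose e (m : 'I_n + 'I_n) : R := match m with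
      | inl m => c1 * ((m == i)%:R - (m == j)%:R)
      | inr m => c2 * ((m == k)%:R - (m == l)%:R) end.
    have diff (c : R) (W : lmodType R) (f : 'I_n -> W) i1 i2 : i1 != i2 ->
        \sum_m (c * ((m == i1)%:R - (m == i2)%:R)) *: f m = c *: (f i1 - f i2).
      move=> i12; rewrite (sum_two _ i12); last first.
        by move=> m /negPf-> /negPf->; rewrite subrr mulr0.
      by rewrite !eqxx [i2 == i1]eq_sym (negPf i12) subr0 sub0r mulr1 mulrN1 scaleNr scalerBr.
    have e0 : forall m, e m = 0.
      apply: ba => [[m am|m am]|].
      - rewrite /e; case: eqP => [mi|_]; first by rewrite -mi am eqxx in ai.
        case: eqP => [mj|_]; first by rewrite -mj am eqxx in aj.
        by rewrite subrr mulr0.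
      - rewrite /e; case: eqP => [mi|_]; first by rewrite -mi am eqxx in ak.
        case: eqP => [mj|_]; first by rewrite -mj am eqxx in al.
        by rewrite subrr mulr0.
      apply/pair_system0; rewrite /e; split.
      - by rewrite sum_regular diff// subrr scaler0.
      - by rewrite sum_regular diff// subrr scaler0.
      - by rewrite !diff.
    have := e0 (inl i); have := e0 (inr k); rewrite /e !eqxx (negPf ij) (negPf kl).
    by rewrite !subr0 !mulr1.
  (* [y] need not be injective, but a point repeated in the support is already a dependency. *)
  have [yij|yij] := eqVneq (y i) (y j).
    have [|/eqP] := dep 1 0; first by rewrite yij subrr scale0r scaler0.
    by rewrite oner_eq0.
  have o1 : orient (y i) (y j) (y l) = 0.
    have [t /andP[t0 _]] := sbetween_orient (y i) (y j) sR.
    rewrite (sbetween_online sL) o0 mulr0 add0r => /esym/eqP.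
    by rewrite mulf_eq0 gt_eqF//= => /eqP.
  have [r rE] := lineP yij o0; have [t tE] := lineP yij o1.
  have [|_ /eqP] := dep (t - r) 1; last by rewrite oner_eq0.
  by rewrite rE tE; apply: rv2P; rewrite !mxE; ring.
- split; first by case=> i; [exact: a10|exact: a20].
  by apply/pair_systemE; split; rewrite ?add0r// -pE1 -pE2.
- by case=> i; [exact: a1A|exact: a2B].
Qed.

End CompleteLattice.

Theorem complete_finite_lattice (R : realType) (P : set 'rV[R]_2) :
  finite_set P -> complete P -> finite_set (convex_lattice P).
Proof.
move=> /finite_seqP[s ->] cs; pose y (i : 'I_(size s)) := s`_i.
have yE : range y = [set` s].
  apply/seteqP; split=> [_ [i _ <-]|x /= /mem_seq_nth[i i_s ->]].
    by rewrite /= mem_nth.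
  by exists (Ordinal i_s).
rewrite -yE in cs *.
apply: (@sub_finite_set _ _ (range (fun K : {set 'I_(size s)} => hull y (mem K)))).
  apply: smallest_sub; last first.
    move=> _ [_ [i _ <-] <-]; exists [set i]%SET => //; rewrite /hull -[RHS]ch_set1.
    congr ch; apply/seteqP; split=> [q [j /=]|q ->].
      by rewrite inE => /eqP-> <-.
    by exists i => //=; rewrite inE.
  split.
  - by move=> _ [K _ <-]; apply: ch_convex.
  - move=> _ _ [K _ <-] [L _ <-]; rewrite hull_capE//.
    exists [set i | `[< hull y (mem K) (y i) /\ hull y (mem L) (y i) >]]%SET => //.
    by rewrite /hull; congr ch; apply/seteqP; split=> q [i /= ih <-]; exists i => //=;
      move: ih; rewrite ?inE.
  - move=> _ _ [K _ <-] [L _ <-]; exists (K :|: L)%SET => //.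
    rewrite /hull ch_setU; congr ch; apply/seteqP; split.
      move=> q [i /=]; rewrite inE => /orP[iK|iL] <-; [left|right]; by exists i.
    by move=> q [[i iK <-]|[i iL <-]]; exists i => //=; rewrite inE; apply/orP; [left|right].
exact/finite_image/finite_finset.
Qed.

(** * Diamonds *)

Section Diamonds.
Context {R : realType}.
Local Notation V := ('rV[R]_2).
Implicit Types (x y z w u v p s : V) (t : R) (P X Y : set V).

Lemma axial_sub X P : X `<=` P -> axial P -> axial X.
Proof.
move=> XP [u [w [s [s' [uw offP ss']]]]]; exists u, w, s, s'; split=> //.
by move=> x /XP/offP.
Qed.

(** A diamond needs two points strictly on opposite sides of its axis, even if [P] has fewer points
    off the line. The missing ones are invented, by reflection through [u]. *)
Lemma axial_strict P : axial P -> exists u w s s', [/\ u != w,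
  forall x, P x -> [\/ orient u w x = 0, x = s | x = s']
  & orient u w s * orient u w s' < 0].
Proof.
move=> [u [w [s [s' [uw offP ss']]]]].
(* [n - u] is [w - u] turned by a right angle. *)
pose n : V := \row_j [:: u 0 0 - (w 0 1 - u 0 1); u 0 1 + (w 0 0 - u 0 0)]`_j.
have n0 : 0 < orient u w n.
  rewrite (_ : orient u w n = sqdist w u); last by rewrite /orient !mxE /sqdist /=; ring.
  by rewrite lt_neqAle sqdist_ge0 eq_sym sqdist_eq0 eq_sym uw.
have refl x : orient u w (2 *: u - x) = - orient u w x by rewrite /orient !mxE; ring.
have half a b : (forall x, P x -> [\/ orient u w x = 0, x = a | x = b]) ->
    orient u w a = 0 -> exists a' b', (forall x, P x -> [\/ orient u w x = 0, x = a' | x = b'])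
      /\ orient u w a' * orient u w b' < 0.
  move=> off a0; have off' x : P x -> orient u w x = 0 \/ x = b.
    by move=> /off[|->|]; auto.
  have [b0|b0] := eqVneq (orient u w b) 0.
    exists n, (2 *: u - n); split; last by rewrite refl mulrN oppr_lt0 mulr_gt0.
    by move=> x /off'[|->]; [exact: Or31|apply: Or31].
  exists (2 *: u - b), b; split; last by rewrite refl mulNr oppr_lt0 mulrr_gt0_neq0.
  by move=> x /off'[|->]; [exact: Or31|exact: Or33].
have [ss0|ss0] := eqVneq (orient u w s * orient u w s') 0; last first.
  by exists u, w, s, s'; split=> //; rewrite lt_neqAle ss0.
have [a' [b' [off ab]]] : exists a' b', (forall x, P x ->
    [\/ orient u w x = 0, x = a' | x = b']) /\ orient u w a' * orient u w b' < 0.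
  move/eqP: ss0; rewrite mulf_eq0 => /orP[]/eqP e; first exact: (half s s').
  by apply: (half s' s) => // x /offP[]; [exact: Or31|exact: Or33|exact: Or32].
by exists u, w, a', b'.
Qed.

Lemma segment_param u v (a b c : R) : a <= b -> b <= c ->
  segment (u + a *: v) (u + c *: v) (u + b *: v).
Proof.
move=> ab bc; have [ac|ac] := eqVneq a c.
  have -> : b = a by apply/eqP; rewrite eq_le ab andbT ac bc.
  exists 0; first by rewrite /= lexx ler01.
  by rewrite subr0 scale1r scale0r addr0.
have d0 : 0 < c - a by rewrite subr_gt0 lt_neqAle ac (le_trans ab).
exists ((b - a) / (c - a)).
  rewrite /=; apply/andP; split; first by rewrite divr_ge0 ?(ltW d0)// subr_ge0.
  by rewrite ler_pdivrMr// mul1r; lra.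
by apply: rv2P; rewrite !mxE; field; rewrite gt_eqF.
Qed.

Lemma sorted_head_last (s : seq R) (x x0 : R) : sorted <=%O s -> x \in s ->
  head x0 s <= x <= last x0 s.
Proof.
move=> ss /[dup] xs /(nth_index x0) <-; rewrite -nth0 -nth_last.
have i_s : (index x s < size s)%N by rewrite index_mem.
have s0 : (0 < size s)%N by rewrite (leq_ltn_trans _ i_s).
have le_nth := sorted_leq_nth le_trans lexx x0 ss.
by apply/andP; split; apply: le_nth; rewrite ?inE ?prednK// -ltnS prednK.
Qed.

Lemma axis_crossing_unique u w s s' x y (a b : R) :
  orient u w s != orient u w s' -> x = (1 - a) *: s + a *: s' ->
  y = (1 - b) *: s + b *: s' -> orient u w x = 0 -> orient u w y = 0 -> x = y.
Proof.
move=> ss' -> -> ; rewrite !orient_affine => x0 y0.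
suff -> : a = b by [].
move: ss' x0 y0; set A := orient u w s; set B := orient u w s' => AB x0 y0.
have /eqP : (a - b) * (A - B) = 0 by lra.
by rewrite mulf_eq0 [A - B == 0]subr_eq0 (negPf AB) orbF subr_eq0 => /eqP.
Qed.

Lemma axial_sub_diamond X : finite_set X -> axial X ->
  exists (p q : nat) Y, is_diamond p q Y /\ X `<=` Y.
Proof.
move=> /finite_seqP[xs ->] /axial_strict[u [w [s [s' [uw offX ss']]]]].
pose pt (r : R) : V := u + r *: (w - u).
have pt_inj : injective pt.
  move=> a b /addrI /eqP; rewrite -subr_eq0 -scalerBl scaler_eq0 subr_eq0.
  by rewrite [w - u == 0]subr_eq0 eq_sym [w == u]eq_sym (negPf uw) orbF eq_sym => /eqP.
have f_pt r : orient u w (pt r) = 0 by exact: orient_param.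
have /choice[tau tauE] : forall x, exists r, orient u w x = 0 -> x = pt r.
  move=> x; have [/(lineP uw)[r rE]|nx] := pselect (orient u w x = 0).
    by exists r.
  by exists 0.
have s_s' : orient u w s != orient u w s'.
  by apply/eqP => e; move: ss'; rewrite e -expr2 ltNge sqr_ge0.
have [t0 [t01 c0]] : exists t, 0 <= t <= 1 /\ orient u w ((1 - t) *: s + t *: s') = 0.
  exists (orient u w s / (orient u w s - orient u w s')).
  move: ss' s_s'; rewrite orient_affine.
  set A := orient u w s; set B := orient u w s' => AB nAB.
  have D0 : A - B != 0 by rewrite subr_eq0.
  split; last by field.
  have [D|D|D] := ltgtP (A - B) 0; last by rewrite D eqxx in D0.
  - by rewrite ler_ndivlMr// ler_ndivrMr//; nra.
  - by rewrite ler_pdivlMr// ler_pdivrMr//; nra.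
set c := _ + _ in c0; pose tc := tau c; have cE : c = pt tc by exact: tauE.
(* The parameters [tc + 1] and [tc + 2] guarantee three axis points. Points of [xs] off the axis
   have an arbitrary [tau] and contribute harmless extra ones. *)
pose ts := sort <=%O (undup [:: tc, tc + 1, tc + 2 & map tau xs]).
have ts_uniq : uniq ts by rewrite sort_uniq undup_uniq.
have ts_sorted : sorted <=%O ts by apply: sort_sorted; exact: le_total.
have mem_ts r : (r \in ts) = (r \in [:: tc, tc + 1, tc + 2 & map tau xs]).
  by rewrite mem_sort mem_undup.
have ts3 : (3 <= size ts)%N.
  apply: (@uniq_leq_size _ [:: tc; tc + 1; tc + 2]).
    by rewrite /= !inE; apply/and3P; split=> //; [apply/norP; split|]; apply/eqP; lra.
  by move=> r; rewrite mem_ts !inE => /or3P[]->; rewrite ?orbT.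
have tcts : tc \in ts by rewrite mem_ts mem_head.
have [ta [tb tsE]] : exists ta tb, ts = ta ++ tc :: tb.
  by case/splitPr: tcts => ta tb; exists ta, tb.
pose axis := map pt ta ++ c :: map pt tb.
have axisE : axis = map pt ts by rewrite tsE map_cat /= -cE.
exists (size ta), (size tb), [set` axis ++ [:: s; s']]; split; last first.
  move=> x /= xxs; rewrite mem_cat axisE.
  case: (offX x xxs) => [x0|->|->]; last 2 first.
  - by rewrite !inE eqxx !orbT.
  - by rewrite !inE eqxx !orbT.
  by rewrite (tauE x x0) map_f// mem_ts !inE map_f ?orbT.
have headE : head c axis = pt (head tc ts) by rewrite axisE cE; case: (ts).
have lastE : last c axis = pt (last tc ts) by rewrite axisE cE last_map.
have chain_axis : chain axis.
  rewrite axisE; split; first by rewrite map_inj_uniq.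
    by exists u, (w - u); move=> z /= /mapP[r _ ->]; exists r.
  move=> i j k ij jk; rewrite size_map => ks.
  have js := ltn_trans jk ks; have i_s := ltn_trans ij js.
  rewrite !(nth_map 0)//; have le_nth := sorted_leq_nth le_trans lexx 0 ts_sorted.
  by apply: segment_param; apply: le_nth; rewrite ?inE// ltnW.
have off x : orient u w x != 0 -> ~ line (head c axis) (last c axis) x.
  move=> x0 [r _ xE]; move/eqP: x0; apply; rewrite -xE headE lastE /pt.
  by rewrite /orient !mxE; ring.
split; first by rewrite /diamond_index; move: ts3; rewrite tsE size_cat /=;
  case: (size ta) (size tb) => [|[|?]] [|[|?]].
exists (map pt ta), (map pt tb), c, s, s'; split=> //.
- by rewrite !size_map.
- split; first by move=> e; rewrite e eqxx in s_s'.
  + by apply: off; apply/eqP => e; rewrite e mul0r ltxx in ss'.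
  + by apply: off; apply/eqP => e; rewrite e mulr0 ltxx in ss'.
- rewrite -/axis headE lastE; apply/seteqP; split=> [x [[a _ xE] [b _ xE']]|_ ->] /=.
    apply: (@axis_crossing_unique u w s s' _ _ a t0) => //.
    by rewrite -xE' /pt /orient !mxE; ring.
  split; first by exists t0.
  have /andP[h l] := sorted_head_last tc ts_sorted tcts.
  by rewrite cE; apply: segment_param.
Qed.

(* All that is used about a diamond with c in it: the axis lies on the line
   x0 x1 and c is where this line meets s s'. *)
Definition skewered x0 x1 s s' c Y : Prop :=
  [/\ x0 != x1, (forall x, Y x -> [\/ orient x0 x1 x = 0, x = s | x = s']),
      Y c /\ orient x0 x1 c = 0, segment s s' c
    & orient x0 x1 s * orient x0 x1 s' < 0].

Lemma diamond_skewered (p q : nat) Y : is_diamond p q Y ->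
  exists x0 x1 s s' c, skewered x0 x1 s s' c Y.
Proof.
move=> [pq [a [b [c [s [s' [[ap bq] ch_axis [ss' ls ls'] capE YE]]]]]]].
set axis := a ++ c :: b in ch_axis ls ls' capE YE.
set x0 := head c axis in ls ls' capE; set x1 := last c axis in ls ls' capE.
have [uniq_axis [o [v lin]] _] := ch_axis.
have size3 : (3 <= size axis)%N.
  rewrite size_cat /= ap bq; move: pq; rewrite /diamond_index !inE.
  by case: (p) (q) => [|[|?]] [|[|?]]; rewrite ?addSn ?addnS.
have size0 : (0 < size axis)%N by apply: leq_trans size3.
have x0axis : x0 \in axis by rewrite /x0 -nth0 mem_nth.
have x1axis : x1 \in axis by rewrite /x1 -nth_last mem_nth// prednK.
have x01 : x0 != x1.
  rewrite /x0 /x1 -nth0 -nth_last ?nth_uniq ?prednK//.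
  by case: (size axis) size3 => [|[|]].
have f_axis x : x \in axis -> orient x0 x1 x = 0.
  move=> /lin[r _ <-]; have [r0 _ <-] := lin _ x0axis; have [r1 _ <-] := lin _ x1axis.
  by rewrite /orient !mxE; ring.
have f_off x : ~ line x0 x1 x -> orient x0 x1 x != 0.
  by move=> nx; apply/eqP => /(lineP x01)[t tE]; apply: nx; exists t.
have s0 := f_off _ ls; have s'0 := f_off _ ls'.
have caxis : c \in axis by rewrite mem_cat mem_head orbT.
have [t t01 cE] : segment s s' c.
  by have [] : (segment s s' `&` segment x0 x1) c by rewrite capE.
have fss' : orient x0 x1 s * orient x0 x1 s' < 0.
  have := f_axis _ caxis; rewrite -cE orient_affine.
  move: s0 s'0 t01; set A := orient x0 x1 s; set B := orient x0 x1 s'.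
  move=> A0 B0 /andP[t0 t1] e.
  rewrite lt_neqAle mulf_neq0//= leNgt; apply/negP => AB.
  (* If [A] and [B] had the same sign, the left side would be a sum of nonnegative terms, while the
     right side is zero. *)
  have : (1 - t) * (A * A) + t * (A * B) = A * ((1 - t) * A + t * B) by ring.
  rewrite e mulr0 => /eqP; rewrite paddr_eq0; last 2 first.
  - by rewrite mulr_ge0 ?subr_ge0// -expr2 sqr_ge0.
  - by rewrite mulr_ge0// ltW.
  rewrite !mulf_eq0 (negPf A0) (negPf B0) !orbF => /andP[/eqP t1' /eqP t0'].
  by move: t1'; rewrite t0' subr0 => /eqP; rewrite oner_eq0.
exists x0, x1, s, s', c; split=> //.
- rewrite YE => x; rewrite /= mem_cat => /orP[h|].
    by apply: Or31; exact: f_axis.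
  by rewrite !inE => /orP[]/eqP->; [exact: Or32|exact: Or33].
- by split; [rewrite YE /= mem_cat caxis|exact: f_axis].
- by exists t.
Qed.

(** A proper crossing involving an axis segment can only be at [c]. Two segments not contained in
    the axis never cross properly. *)
Lemma skewered_complete x0 x1 s s' c Y : skewered x0 x1 s s' c Y -> complete Y.
Proof.
move=> [x01 YP [Yc c0] [t t01 cE] fss'].
have [s0 s'0] : orient x0 x1 s != 0 /\ orient x0 x1 s' != 0.
  by split; apply/eqP => e; move: fss'; rewrite e ?mul0r ?mulr0 ltxx.
have s_s' : orient x0 x1 s != orient x0 x1 s'.
  by apply/eqP => e; move: fss'; rewrite e -expr2 ltNge sqr_ge0.
have cross_axis x y z w r : orient x0 x1 x = 0 -> orient x0 x1 y = 0 -> Y z -> Y w ->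
    orient x y z * orient x y w < 0 -> sbetween x r y -> sbetween z r w -> Y r.
  move=> xa ya Yz Yw o1 xry zrw; suff -> : r = c by [].
  have xy : x != y by apply/eqP => e; move: o1; rewrite e orient_xxy mul0r ltxx.
  have [k k0 kE] := orient_sub_line x01 xy xa ya.
  have fr : orient x0 x1 r = 0.
    by have [l _ ->] := sbetween_orient x0 x1 xry; rewrite xa ya !mulr0 addr0.
  have {}o1 : orient x0 x1 z * orient x0 x1 w < 0.
    by move: o1; rewrite !kE mulrACA pmulr_rlt0// mulrr_gt0_neq0.
  have fin l : r = (1 - l) *: s + l *: s' -> r = c.
    by move=> rE; apply: (axis_crossing_unique s_s' rE (esym cE) fr c0).
  case: (YP z Yz) (YP w Yw) => [za|zE|zE] [wa|wE|wE].
  - by move: o1; rewrite za mul0r ltxx.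
  - by move: o1; rewrite za mul0r ltxx.
  - by move: o1; rewrite za mul0r ltxx.
  - by move: o1; rewrite wa mulr0 ltxx.
  - by move: o1; rewrite zE wE -expr2 ltNge sqr_ge0.
  - by move: zrw; rewrite zE wE => -[l _ /fin].
  - by move: o1; rewrite wa mulr0 ltxx.
  - by move: zrw; rewrite zE wE => /sbetweenC[l _ /fin].
  - by move: o1; rewrite zE wE -expr2 ltNge sqr_ge0.
(* Such a segment either is [s s'], and then all points off its line are on the axis, or its
   interior lies on the side of its one endpoint [e] off the axis. *)
have one_side x y r : Y x -> Y y -> ~ (orient x0 x1 x = 0 /\ orient x0 x1 y = 0) -> x != y ->
    sbetween x r y -> (forall z, Y z -> orient x y z != 0 -> orient x0 x1 z = 0) \/
    exists e, [/\ e = x \/ e = y, e = s \/ e = s' & 0 < orient x0 x1 r * orient x0 x1 e].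
  move=> Yx Yy nxy xy xry.
  have [l /andP[l0 l1] rE] := sbetween_orient x0 x1 xry.
  have fA (e z : R) : e != 0 -> 0 < z -> 0 < z * e * e.
    by move=> e0 z0; rewrite -mulrA mulr_gt0// mulrr_gt0_neq0.
  case: (YP x Yx) (YP y Yy) => [xa|xE|xE] [ya|yE|yE].
  - by case: nxy.
  - by right; exists s; split; auto; rewrite rE xa mulr0 add0r yE fA.
  - by right; exists s'; split; auto; rewrite rE xa mulr0 add0r yE fA.
  - right; exists s; split; auto.
    by rewrite rE ya mulr0 addr0 xE fA// subr_gt0.
  - by rewrite xE yE eqxx in xy.
  - left=> z Yz; rewrite xE yE; case: (YP z Yz) => [//|->|->].
      by rewrite orient_xyx eqxx.
    by rewrite orient_xyy eqxx.
  - right; exists s'; split; auto.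
    by rewrite rE ya mulr0 addr0 xE fA// subr_gt0.
  - left=> z Yz; rewrite xE yE; case: (YP z Yz) => [//|->|->].
      by rewrite orient_xyy eqxx.
    by rewrite orient_xyx eqxx.
  - by rewrite xE yE eqxx in xy.
apply: complete_strict => x y z w r Yx Yy Yz Yw o1 o2 xry zrw.
have [[xa ya]|nxy] := pselect (orient x0 x1 x = 0 /\ orient x0 x1 y = 0).
  exact: (cross_axis x y z w).
have [[za wa]|nzw] := pselect (orient x0 x1 z = 0 /\ orient x0 x1 w = 0).
  exact: (cross_axis z w x y).
have xy : x != y by apply/eqP => e; move: o1; rewrite e orient_xxy mul0r ltxx.
have zw : z != w by apply/eqP => e; move: o2; rewrite e orient_xxy mul0r ltxx.
have nz a1 a2 : a1 * a2 < 0 -> a1 != 0 /\ a2 != 0 :> R.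
  by move=> h; split; apply/eqP => e; move: h; rewrite e ?mul0r ?mulr0 ltxx.
have [n1 n2] := nz _ _ o1; have [n3 n4] := nz _ _ o2.
case: (one_side x y r Yx Yy nxy xy xry) => [ax|[e [exy es er]]].
  by case: nzw; split; apply: ax.
case: (one_side z w r Yz Yw nzw zw zrw) => [ax|[e' [ezw es' er']]].
  by case: nxy; split; apply: ax.
(* [r] is on the side of both, and [s] and [s'] are on opposite sides. So the segments share an
   endpoint, which rules out a proper crossing. *)
have ee' : e = e'.
  have : 0 < orient x0 x1 e * orient x0 x1 e'.
    by apply: (@same_sign_trans _ _ (orient x0 x1 r)) => //; rewrite mulrC.
  case: es es' => [->|->] [->|->] //; rewrite ltNge ?(ltW fss')//.
  by rewrite mulrC (ltW fss').
exfalso; subst e'; case: exy ezw => [->|->] [e'|e'];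
  by move: n1 n2; rewrite -?e' ?orient_xyx ?orient_xyy ?eqxx.
Qed.

Lemma diamond_finite (p q : nat) Y : is_diamond p q Y -> finite_set Y.
Proof. by move=> [_ [a [b [c [s [s' [_ _ _ _ ->]]]]]]]; exact: finite_seq. Qed.

End Diamonds.

(** * From a finite lattice to its one-point elements *)

Section LatticePoints.
Context {R : realType}.
Local Notation V := ('rV[R]_2).
Implicit Types (x y z w u v p s : V) (t : R) (P X Y : set V).

Lemma ch_pair x y : ch [set x; y] = segment x y.
Proof.
apply/seteqP; split.
  apply: ch_min; last first.
    by move=> _ [->|->]; [exists 0|exists 1] => /=; rewrite ?lexx ?ler01//
      ?subr0 ?subrr ?scale1r ?scale0r ?addr0 ?add0r.
  apply/convex_setP => _ _ t [a /andP[a0 a1] <-] [b /andP[b0 b1] <-] /andP[t0 t1].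
  exists ((1 - t) * a + t * b); first by rewrite /=; apply/andP; split; nra.
  by apply: rv2P; rewrite !mxE; ring.
move=> _ [t t01 <-]; have /convex_setP := @ch_convex R 2 [set x; y].
by apply=> //; apply: sub_ch; [left|right].
Qed.

Lemma sbetween_segment x p y : sbetween x p y -> segment x y p.
Proof. by move=> [t /andP[t0 t1] ->]; exists t; rewrite //= !ltW. Qed.

Lemma segment_sbetween x p y : segment x y p -> p <> x -> p <> y -> sbetween x p y.
Proof.
move=> [t /andP[t0 t1] <-] px py; exists t => //; apply/andP; split.
  rewrite lt_neqAle t0 andbT; apply/eqP => e; apply: px.
  by rewrite -e subr0 scale1r scale0r addr0.
rewrite lt_neqAle t1 andbT; apply/eqP => e; apply: py.
by rewrite e subrr scale0r scale1r add0r.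
Qed.

Lemma segment_online x y p : segment x y p -> orient x y p = 0.
Proof. by move=> [t _ <-]; rewrite orient_affine orient_xyx orient_xyy !mulr0 addr0. Qed.

Lemma segment_zero_sides u w x p y : segment x y p -> orient u w p = 0 ->
  orient u w x * orient u w y <= 0.
Proof.
move=> [t /andP[t0 t1] <-]; rewrite orient_affine => e.
rewrite leNgt; apply/negP; move: e; set A := orient u w x; set B := orient u w y => e AB.
have : (1 - t) * (A * A) + t * (A * B) = A * ((1 - t) * A + t * B) by ring.
rewrite e mulr0 => /eqP; rewrite paddr_eq0; last 2 first.
- by rewrite mulr_ge0 ?subr_ge0// -expr2 sqr_ge0.
- by rewrite mulr_ge0// ltW.
rewrite !mulf_eq0 orbb => /andP[].
have A0 : A != 0 by apply/eqP => A0; rewrite A0 mul0r ltxx in AB.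
have B0 : B != 0 by apply/eqP => B0; rewrite B0 mulr0 ltxx in AB.
rewrite (negPf A0) (negPf B0) !orbF => /eqP t1' /eqP t0'.
by move: t1'; rewrite t0' subr0 => /eqP; rewrite oner_eq0.
Qed.

Lemma convex_lattice_sublattice X : sublattice (convex_lattice X).
Proof.
split=> [A KA|A B KA KB K sK|A B KA KB K sK].
- apply: (KA (@convex_set R V)); split.
    split=> // [B C /convex_setP cB /convex_setP cC|B C _ _]; last exact: ch_convex.
    apply/convex_setP => x y t [Bx Cx] [By Cy] t01.
    by split; [apply: cB|apply: cC].
  move=> _ [x _ <-]; apply/convex_setP => a b t -> -> _ /=.
  by rewrite -scalerDl subrK scale1r.
- have [[_ + _] _] := sK; apply; [exact: KA|exact: KB].
- have [[_ _ +] _] := sK; apply; [exact: KA|exact: KB].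
Qed.

Definition lattice_points X : set V := [set p | convex_lattice X [set p]].

Lemma sub_lattice_points X : X `<=` lattice_points X.
Proof. by move=> x Xx; apply: sub_gen_smallest; exists x. Qed.

Lemma lattice_points_finite X : finite_set (convex_lattice X) ->
  finite_set (lattice_points X).
Proof.
apply: finite_preimage => x y _ _ /seteqP[+ _].
by move=> /(_ x erefl).
Qed.

Lemma lattice_points_complete X : complete (lattice_points X).
Proof.
move=> x y z w p Kx Ky Kz Kw o0 xpy zpw; rewrite /lattice_points /=.
have [_ cap_K cup_K] := convex_lattice_sublattice X.
suff -> : [set p] = ch ([set x] `|` [set y]) `&` ch ([set z] `|` [set w]).
  by apply: cap_K; apply: cup_K.
rewrite !ch_pair; apply/seteqP; split.
  by move=> _ ->; split; apply: sbetween_segment.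
move=> q [xqy [r _ qE]]; have [t /andP[t0 _] pE] := zpw.
rewrite /= -qE pE; suff -> : r = t by [].
have := segment_online xqy; rewrite -qE orient_affine => q0.
have := sbetween_online xpy; rewrite pE orient_affine => p0.
move: o0 q0 p0; set A := orient x y z; set B := orient x y w => A0 q0 p0.
have : A * (t - r) = 0.
  rewrite (_ : _ * _ = t * ((1 - r) * A + r * B) - r * ((1 - t) * A + t * B)); last by ring.
  by rewrite q0 p0 !mulr0 subr0.
by move/eqP; rewrite mulf_eq0 (negPf A0) subr_eq0 => /eqP.
Qed.

(** The line through [c], [c'], [b'] serves as axis. Without [a] it separates [b] from [a'], having
    [b'] between them; without [a'] it separates [a] from [b]. Cyclic relabelling covers the other
    points. *)
Lemma pinwheel_minus_axial X a b c a' b' c' : orient a' b' c' != 0 ->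
  sbetween a a' c' -> sbetween b b' a' -> sbetween c c' b' ->
  X `<=` [set` [:: a; b; c; a'; b'; c']] -> ~ X a \/ ~ X a' -> axial X.
Proof.
move=> D0 h1 h2 h3 XP nX.
have sg l m n := @pinwheel_sgz _ a b c a' b' c' l m n h1 h2 h3.
have cb : c != b'.
  apply: contra_neq D0 => e; move: h3; rewrite e => -[t _].
  by rewrite -scalerDl subrK scale1r => ->; rewrite orient_xyy.
have c0 : orient c b' c' = 0 by exact: sbetween_online.
case: nX => nX.
  exists c, b', b, a'; split=> //; last first.
    apply: (@segment_zero_sides _ _ _ b'); first exact: sbetween_segment.
    by rewrite orient_xyy.
  move=> x Xx; move: (XP x Xx); rewrite /= !inE => /or4P[|||/or3P[]] /eqP xE.
  - by case: nX; rewrite -xE.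
  - exact: Or32.
  - by apply: Or31; rewrite xE orient_xyx.
  - exact: Or33.
  - by apply: Or31; rewrite xE orient_xyy.
  - by apply: Or31; rewrite xE.
exists c, b', a, b; split=> //; last first.
  rewrite ltW// -sgz_lt0 sgzM (sg 2 4 0)%N// (sg 2 4 1)%N// mulrACA.
  have -> : sgz (orient a' b' c') * sgz (orient a' b' c') = 1 by case: sgzP D0.
  by vm_compute.
move=> x Xx; move: (XP x Xx); rewrite /= !inE => /or4P[|||/or3P[]] /eqP xE.
- exact: Or32.
- exact: Or33.
- by apply: Or31; rewrite xE orient_xyx.
- by case: nX; rewrite -xE.
- by apply: Or31; rewrite xE orient_xyy.
- by apply: Or31; rewrite xE.
Qed.

Lemma pinwheel_proper_axial P X : pinwheel P -> X `<=` P -> X <> P -> axial X.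
Proof.
move=> [a [b [c [a' [b' [c' [D0 h1 h2 h3 ->]]]]]]] XP XnP.
have [q qP nXq] : exists2 q, q \in [:: a; b; c; a'; b'; c'] & ~ X q.
  apply: contrapT => nq; apply: XnP; apply/seteqP; split=> // q qP.
  by apply: contrapT => nXq; apply: nq; exists q.
have perm (x y z x' y' z' : V) : [set` [:: x; y; z; x'; y'; z']] `<=`
    [set` [:: y; z; x; y'; z'; x']].
  by move=> r; rewrite /= !inE => /or4P[|||/or3P[]] ->; rewrite ?orbT.
have XP1 := subset_trans XP (@perm _ _ _ _ _ _).
have XP2 := subset_trans XP1 (@perm _ _ _ _ _ _).
have D1 : orient b' c' a' != 0 by rewrite orient_cycle.
have D2 : orient c' a' b' != 0 by rewrite -orient_cycle.
move: qP; rewrite !inE => /or4P[|||/or3P[]] /eqP qE; subst q.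
- by apply: (@pinwheel_minus_axial X a b c a' b' c') => //; left.
- by apply: (@pinwheel_minus_axial X b c a b' c' a') => //; left.
- by apply: (@pinwheel_minus_axial X c a b c' a' b') => //; left.
- by apply: (@pinwheel_minus_axial X a b c a' b' c') => //; right.
- by apply: (@pinwheel_minus_axial X b c a b' c' a') => //; right.
- by apply: (@pinwheel_minus_axial X c a b c' a' b') => //; right.
Qed.

Lemma equivalent_refl X : equivalent X X.
Proof.
exists id; last by move=> A _; rewrite !image_id.
by split=> [x//|x y _ _//|x Xx]; exists x.
Qed.

End LatticePoints.

(** * Transfer along equivalences *)

Section Transfer.
Context {R : realType}.
Local Notation V := ('rV[R]_2).
Implicit Types (x y z w u v p s : V) (t : R) (P X Y : set V).

Lemma segmentC x y : segment x y = segment y x.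
Proof.
by rewrite -!ch_pair; congr ch; apply/seteqP; split=> z [->|->]; [right|left|right|left].
Qed.

Lemma collinear_segment x y z : orient x y z = 0 ->
  [\/ segment x y z, segment y z x | segment x z y].
Proof.
move=> o0; have [->|xy] := eqVneq x y.
  apply: Or32; exists 0; first by rewrite /= lexx ler01.
  by rewrite subr0 scale1r scale0r addr0.
have [t zE] := lineP xy o0.
have simp : (x + 0 *: (y - x) = x) * (x + 1 *: (y - x) = y).
  by rewrite scale0r addr0 scale1r addrC subrK.
have seg := @segment_param _ x (y - x).
have [t0|t0] := leP t 0.
  by apply: Or32; have := seg t 0 1 t0 ler01; rewrite -zE !simp segmentC.
have [t1|t1] := leP t 1.
  by apply: Or31; have := seg 0 t 1 (ltW t0) t1; rewrite -zE !simp.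
by apply: Or33; have := seg 0 1 t ler01 (ltW t1); rewrite -zE !simp.
Qed.

Section Equivalence.
Variables (X Y : set V) (f : V -> V).
Hypothesis f_bij : set_bij X Y f.
Hypothesis f_Rch : forall A, A `<=` X -> f @` Rch X A = Rch Y (f @` A).

Lemma equiv_inj x y : X x -> X y -> f x = f y -> x = y.
Proof. by move=> Xx Xy; apply: (set_bij_inj f_bij); rewrite inE. Qed.

Lemma equiv_mem x : X x -> Y (f x).
Proof. exact: (set_bij_homo f_bij). Qed.

Lemma equiv_surj y : Y y -> exists2 x, X x & f x = y.
Proof. exact: (set_bij_surj f_bij). Qed.

Lemma equiv_ch A x : A `<=` X -> X x -> ch A x <-> ch (f @` A) (f x).
Proof.
move=> AX Xx; have E := f_Rch AX; split=> h.
  by have [] : Rch Y (f @` A) (f x) by rewrite -E; exists x.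
have [z [Az Xz] /(equiv_inj Xz Xx) <-//] : (f @` Rch X A) (f x).
by rewrite E; split=> //; exact: equiv_mem.
Qed.

Lemma equiv_segment x y p : X x -> X y -> X p ->
  segment x y p <-> segment (f x) (f y) (f p).
Proof.
move=> Xx Xy Xp; rewrite -!ch_pair.
have -> : [set f x; f y] = f @` [set x; y] by rewrite image_setU !image_set1.
by apply: equiv_ch => // _ [->|->].
Qed.

(** Three points are collinear exactly if one is in the hull of the other two, and this an
    equivalence preserves. *)
Lemma equiv_collinear x y z : X x -> X y -> X z ->
  orient x y z = 0 <-> orient (f x) (f y) (f z) = 0.
Proof.
move=> Xx Xy Xz.
have rot a b c : segment b c a -> orient a b c = 0.
  by move=> /segment_online; rewrite orient_cycle.
have swap a b c : segment a c b -> orient a b c = 0.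
  by move=> /segment_online; rewrite orientC => /eqP; rewrite oppr_eq0 => /eqP.
split=> /collinear_segment[].
- by move=> /(equiv_segment Xx Xy Xz)/segment_online.
- by move=> /(equiv_segment Xy Xz Xx)/rot.
- by move=> /(equiv_segment Xx Xz Xy)/swap.
- by move=> /(equiv_segment Xx Xy Xz)/segment_online.
- by move=> /(equiv_segment Xy Xz Xx)/rot.
- by move=> /(equiv_segment Xx Xz Xy)/swap.
Qed.

End Equivalence.

(** Contains a triangle that touches the line [u w] in the single vertex [w], and so shows that it
    has no other point on this line. *)
Lemma half_plane_with_point_convex u w (A : R) :
  @convex_set R V [set z | 0 < A * orient u w z \/ z = w].
Proof.
apply/convex_setP => x y t hx hy /andP[t0 t1].
have [t0'|tn0] := eqVneq t 0; first by rewrite t0' subr0 scale1r scale0r addr0.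
have [t1'|tn1] := eqVneq t 1; first by rewrite t1' subrr scale0r scale1r add0r.
have tp : 0 < t by rewrite lt_neqAle eq_sym tn0.
have tq : 0 < 1 - t by rewrite subr_gt0 lt_neqAle tn1.
have e : A * ((1 - t) * orient u w x + t * orient u w y) =
  (1 - t) * (A * orient u w x) + t * (A * orient u w y) by ring.
rewrite /= orient_affine e.
case: hx hy => [hx|->] [hy|->]; rewrite ?orient_xyy ?mulr0 ?addr0 ?add0r.
- by left; rewrite addr_gt0// mulr_gt0.
- by left; rewrite mulr_gt0.
- by left; rewrite mulr_gt0.
- by right; rewrite -scalerDl subrK scale1r.
Qed.

(** If neither [s v] nor [x y] weakly separates the other two points, the four are in convex
    position and a diagonal serves as axis. *)
Lemma four_points_axial X s v x y : s != v -> x != y ->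
  (forall p, X p -> p \in [:: s; v; x; y]) -> axial X.
Proof.
move=> sv xy XE.
have [h|h1] := leP (orient s v x * orient s v y) 0.
  exists s, v, x, y; split=> // p /XE; rewrite !inE => /or4P[]/eqP->.
  - by apply: Or31; rewrite orient_xyx.
  - by apply: Or31; rewrite orient_xyy.
  - exact: Or32.
  - exact: Or33.
have [h|h2] := leP (orient x y s * orient x y v) 0.
  exists x, y, s, v; split=> // p /XE; rewrite !inE => /or4P[]/eqP->.
  - exact: Or32.
  - exact: Or33.
  - by apply: Or31; rewrite orient_xyx.
  - by apply: Or31; rewrite orient_xyy.
have [[h _]|[h _]] := convex_position_diagonals h1 h2.
  exists s, x, v, y; split; last exact: ltW.
    by apply/eqP => e; move: h; rewrite e orient_xxy mul0r ltxx.
  move=> p /XE; rewrite !inE => /or4P[]/eqP->.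
  - by apply: Or31; rewrite orient_xyx.
  - exact: Or32.
  - by apply: Or31; rewrite orient_xyy.
  - exact: Or33.
exists s, y, v, x; split; last exact: ltW.
  by apply/eqP => e; move: h; rewrite e orient_xxy mul0r ltxx.
move=> p /XE; rewrite !inE => /or4P[]/eqP->.
- by apply: Or31; rewrite orient_xyx.
- exact: Or32.
- exact: Or33.
- by apply: Or31; rewrite orient_xyy.
Qed.

Lemma pairwise_collinear (C : set V) :
  (forall x y z, C x -> C y -> C z -> orient x y z = 0) ->
  exists u w, u != w /\ forall x, C x -> orient u w x = 0.
Proof.
move=> CE; have [[u [w [Cu Cw uw]]]|nC] :=
  pselect (exists u w, [/\ C u, C w & u != w]).
  by exists u, w; split=> // x Cx; apply: CE.
have ne u : u != u + const_mx 1.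
  apply/eqP => /rowP/(_ 0); rewrite !mxE => /eqP.
  by rewrite -subr_eq0 opprD addNKr oppr_eq0 oner_eq0.
have [[u Cu]|nu] := pselect (exists u, C u); last first.
  by exists 0, (0 + const_mx 1); split=> // x Cx; case: nu; exists x.
exists u, (u + const_mx 1); split=> // x Cx.
have -> : x = u by apply/eqP; apply: contraT => xu; case: nC; exists x, u.
exact: orient_xyx.
Qed.

(** The preimage of the axis is collinear; the issue is whether its line separates the preimages
    [a], [b] of [s], [s']. If [c] has a preimage, it lies between them. Otherwise the separation
    must be read off from hulls of other points, and it may even fail when few points are left. *)
Lemma skewered_sub_axial x0 x1 s s' c X Y Z : skewered x0 x1 s s' c Y ->
  Z `<=` Y -> equivalent X Z -> axial X.
Proof.
move=> [x01 YP [Yc c0] sc fss'] ZY [f f_bij f_Rch].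
pose C := [set x | X x /\ orient x0 x1 (f x) = 0].
have offC x : X x -> [\/ C x, f x = s | f x = s'].
  move=> Xx; case: (YP (f x) (ZY _ (equiv_mem f_bij Xx))) => h.
  - exact: Or31.
  - exact: Or32.
  - exact: Or33.
have Ccol x y z : C x -> C y -> C z -> orient x y z = 0.
  move=> [Xx fx] [Xy fy] [Xz fz]; apply/(equiv_collinear f_bij f_Rch) => //.
  have [->|xy] := eqVneq (f x) (f y); first exact: orient_xxy.
  by have [k _ ->] := orient_sub_line x01 xy fx fy; rewrite fz mulr0.
have fE x y : X x -> X y -> f x = f y -> x = y by exact: (equiv_inj f_bij).
have [u0 [w0 [uw0 C0]]] := pairwise_collinear Ccol.
have [[a [Xa fa]]|na] := pselect (exists a, X a /\ f a = s); last first.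
  have [b bE] : exists b, forall x, X x -> f x = s' -> x = b.
    have [[b [Xb fb]]|nb] := pselect (exists b, X b /\ f b = s').
      by exists b => x Xx fx; apply: fE => //; rewrite fx.
    by exists u0 => x Xx fx; case: nb; exists x.
  exists u0, w0, b, u0; split=> //; last by rewrite orient_xyx mulr0.
  move=> x Xx; case: (offC x Xx) => [/C0|fx|fx]; first exact: Or31.
    by case: na; exists x.
  by apply: Or32; exact: bE.
have [[b [Xb fb]]|nb] := pselect (exists b, X b /\ f b = s'); last first.
  exists u0, w0, a, u0; split=> //; last by rewrite orient_xyx mulr0.
  move=> x Xx; case: (offC x Xx) => [/C0|fx|fx]; first exact: Or31.
    by apply: Or32; apply: fE => //; rewrite fx.
  by case: nb; exists x.
have ab : a != b.
  by apply/eqP => e; move: fss'; rewrite -fa -fb e -expr2 ltNge sqr_ge0.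
have offab x : X x -> [\/ C x, x = a | x = b].
  move=> Xx; case: (offC x Xx) => [h|fx|fx]; first exact: Or31.
    by apply: Or32; apply: fE => //; rewrite fx.
  by apply: Or33; apply: fE => //; rewrite fx.
have axial_line u w : C u -> C w -> u != w -> orient u w a * orient u w b <= 0 ->
    axial X.
  move=> Cu Cw uw h; exists u, w, a, b; split=> // x /offab[h'||].
  - by apply: Or31; exact: Ccol.
  - exact: Or32.
  - exact: Or33.
have [[u [w [Cu Cw uw]]]|nC] := pselect (exists u w, [/\ C u, C w & u != w]); last first.
  have [d dE] : exists d, forall x, C x -> x = d.
    have [[d Cd]|nd] := pselect (exists d, C d).
      exists d => x Cx; apply/eqP; apply: contraT => xd; case: nC.
      by exists x, d.
    by exists a => x Cx; case: nd; exists x.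
  exists a, b, d, a; split=> //; last by rewrite orient_xyx mulr0.
  move=> x /offab[/dE->|->|->]; [exact: Or32|exact: Or33|].
  by apply: Or31; rewrite orient_xyy.
have [[g [Xg fg]]|nc] := pselect (exists g, X g /\ f g = c).
  apply: (axial_line u w) => //; apply: (@segment_zero_sides _ u w _ g).
    by apply/(equiv_segment f_bij f_Rch) => //; rewrite fa fb fg.
  by apply: Ccol => //; split; rewrite ?fg.
(* Along the axis [orient s s'] is affine and vanishes at [c] only, so [rho y / rho z] is the
   position of [f y] on the way from [c] to [f z]. *)
pose rho z := orient s s' (f z).
have rho_c : orient s s' c = 0 := segment_online sc.
have ss' : s != s' by rewrite -fa -fb; apply: contra_neq ab; exact: fE.
have fs0 : orient x0 x1 s != 0 by apply/eqP => e; rewrite e mul0r ltxx in fss'.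
have rho0 z : C z -> rho z != 0.
  move=> [Xz fz]; apply/eqP => rz.
  have zc : f z != c by apply/eqP => e; case: nc; exists z.
  have [k k0 kE] := orient_sub_line x01 zc fz c0.
  have [k' _ k'E] := orient_sub_line ss' zc rz rho_c.
  have := kE s; rewrite k'E orient_xyx mulr0 => /esym/eqP.
  by rewrite mulf_eq0 (negPf k0) (negPf fs0).
(* If f u lies between c and f w, it is in the triangle s s' (f w), so u is in
   the triangle a b w, which forces a and b apart. *)
have nested y z : C y -> C z -> y != z -> 0 < rho y / rho z -> rho y / rho z <= 1 ->
    axial X.
  move=> Cy Cz yz l0 l1; apply: (axial_line y z) => //.
  have [Xy fy] := Cy; have [Xz fz] := Cz.
  have cz : c != f z by apply/eqP => e; case: nc; exists z.
  have col : orient c (f z) (f y) = 0.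
    by have [k _ ->] := orient_sub_line x01 cz c0 fz; rewrite fy mulr0.
  have [t tE] := lineP cz col.
  have tE' : f y = (1 - t) *: c + t *: f z by apply: rv2P; rewrite tE !mxE; ring.
  have tl : t = rho y / rho z.
    rewrite /rho tE' orient_affine rho_c mulr0 add0r mulfK//.
    exact: rho0.
  have : ch [set a; b; z] y.
    apply/(equiv_ch f_bij f_Rch) => //.
      by move=> _ [[->|->]|->].
    rewrite !image_setU !image_set1 fa fb tE'.
    have /convex_setP := @ch_convex R 2 ([set s; s'] `|` [set f z]); apply.
    - by move: sc; rewrite -ch_pair; apply: ch_mono => x; left.
    - by apply: sub_ch; right.
    - by rewrite tl ltW.
  rewrite leNgt; move=> hy; apply/negP => h.
  (* With [a] and [b] strictly on one side of [y z], the triangle would meet this line only in [z],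
     but it contains [y]. *)
  have hull : ch [set a; b; z] `<=` [set x | 0 < orient y z a * orient y z x \/ x = z].
    apply: ch_min; first exact: half_plane_with_point_convex.
    by move=> _ [[->|->]|->]; [left; exact: mulrr_gt0 h|left|right].
  by case: (hull y hy) => [|e]; [rewrite orient_xyx mulr0 ltxx|rewrite e eqxx in yz].
have [[y [z [Cy Cz yz ryz]]]|nrho] := pselect (exists y z,
    [/\ C y, C z, y != z & 0 < rho y * rho z]).
  have l0 : 0 < rho y / rho z.
    rewrite (_ : _ / _ = rho y * rho z * (rho z)^-1 ^+ 2); last first.
      by field; exact: rho0.
    by rewrite mulr_gt0// lt_neqAle sqr_ge0 eq_sym sqrf_eq0 invr_eq0 rho0.
  have [l1|l1] := leP (rho y / rho z) 1; first exact: (nested y z).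
  have e : rho z / rho y = (rho y / rho z)^-1 by rewrite invf_div.
  apply: (nested z y) => //; first by rewrite eq_sym.
    by rewrite e invr_gt0.
  by rewrite e invf_le1// ltW.
have neg y z : C y -> C z -> y != z -> rho y * rho z < 0.
  move=> Cy Cz yz; rewrite lt_neqAle mulf_neq0 ?rho0//= leNgt; apply/negP => h.
  by apply: nrho; exists y, z.
(* With no two axis points on one side of [s s'] there are only the two, [u] and [w]. *)
apply: (four_points_axial ab uw) => x /offab[Cx|->|->]; rewrite !inE ?eqxx ?orbT//.
have [->|xu] := eqVneq x u; first by rewrite !orbT.
have [->|xw] := eqVneq x w; first by rewrite !orbT.
have h1 := neg x u Cx Cu xu; have h2 := neg u w Cu Cw uw.
have : 0 < rho x * rho w.
  apply: (@same_sign_trans _ _ (- rho u)); first by rewrite mulrN oppr_gt0.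
  by rewrite mulNr oppr_gt0.
by rewrite ltNge ltW// neg.
Qed.

(** An axial set may itself lack a crossing point. It is enlarged to a diamond, which is complete,
    and the lattice grows with the generating set. *)
Lemma axial_finite_lattice X : finite_set X -> axial X -> finite_set (convex_lattice X).
Proof.
move=> finX /(axial_sub_diamond finX)[p [q [Y [dY XY]]]].
have [x0 [x1 [s [s' [c /skewered_complete cY]]]]] := diamond_skewered dY.
apply: sub_finite_set (complete_finite_lattice (diamond_finite dY) cY).
apply: smallest_sub; first exact: convex_lattice_sublattice.
by move=> _ [x Xx <-]; apply: sub_gen_smallest; exists x => //; exact: XY.
Qed.

End Transfer.

(** * The sporadic configuration *)

Section Sporadic.
Context {R : realType}.
Local Notation V := ('rV[R]_2).
Implicit Types (x y z w u v p s : V) (t : R) (P X Y : set V).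

Lemma uniq_nth3 (s : seq V) (i j k : nat) : uniq s -> (i < size s)%N ->
  (j < size s)%N -> (k < size s)%N -> uniq [:: i; j; k] -> uniq [:: s`_i; s`_j; s`_k].
Proof.
move=> us i_s j_s k_s; rewrite -[X in _ -> uniq X]/(map (nth 0 s) [:: i; j; k]).
rewrite map_inj_in_uniq// => m n; rewrite !inE => m_in n_in; apply: (uniqP 0 us).
  by case/or3P: m_in => /eqP->.
by case/or3P: n_in => /eqP->.
Qed.

Lemma card_ge3P (A : set V) : (`I_3 #<= A)%card <->
  exists x y z, [/\ A x, A y & A z] /\ uniq [:: x; y; z].
Proof.
split=> [/card_leP[f]|[x [y [z [[Ax Ay Az] xyz]]]]].
  pose g i (i3 : (i < 3)%N) : V := val (f (SigSub (mem_set (i3 : `I_3 i)))).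
  have gA i i3 : A (@g i i3) by apply/set_mem/valP.
  have g_inj i j i3 j3 : @g i i3 = @g j j3 -> i = j.
    by move=> /val_inj/(inj (mem_set I) (mem_set I))/(congr1 val).
  exists (g 0%N isT), (g 1%N isT), (g 2%N isT); split; first by split; apply: gA.
  by rewrite /= !inE negb_or -!andbA; apply/and4P; split=> //; apply/eqP => /g_inj.
have inj_g : {in `I_3 &, injective (fun i => nth x [:: x; y; z] i)}.
  move=> i j; rewrite !inE => i3 j3; apply: (uniqP x xyz) => //.
have : (`I_3 #<= (fun i => nth x [:: x; y; z] i) @` `I_3)%card.
  by rewrite (card_le_eqr (inj_card_eq inj_g)) card_lexx.
move=> /card_le_trans; apply; apply: subset_card_le.
by move=> _ [[|[|[|//]]] _ <-].
Qed.

Lemma chain3 x p y : uniq [:: x; p; y] -> sbetween x p y -> chain [:: x; p; y].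
Proof.
move=> xpy b; split=> //.
  exists x, (y - x) => z /=; rewrite !inE => /or3P[]/eqP->.
  - by exists 0 => //; rewrite scale0r addr0.
  - have [t _ ->] := b; exists t => //; apply: rv2P; rewrite !mxE; ring.
  - by exists 1 => //; rewrite scale1r addrC subrK.
by move=> [|[|[|i]]] [|[|[|j]]] [|[|[|k]]] //= _ _ _; exact: sbetween_segment.
Qed.

Lemma chain3_sbetween x p y : chain [:: x; p; y] -> sbetween x p y.
Proof.
move=> [/= + _ /(_ 0 1 2)%N/(_ isT isT isT) /= h]; rewrite !inE negb_or.
move=> /andP[/andP[/eqP xp _] /andP[/eqP py _]].
by apply: segment_sbetween => //; exact: nesym.
Qed.

Definition pinwheel_lines : seq (seq nat) := [:: [:: 0; 3; 5]; [:: 1; 4; 3]; [:: 2; 5; 4]]%N.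

(** The last clause shows that a collinear set containing the triple has no further point. *)
Lemma pinwheel_line_table (i j k : nat) : (i < 6)%N -> (j < 6)%N -> (k < 6)%N ->
  uniq [:: i; j; k] -> pinwheel_sign i j k = 0 ->
  exists2 L, L \in pinwheel_lines & {subset L <= [:: i; j; k]} /\
    forall m, (m < 6)%N -> pinwheel_sign i j m = 0 -> m \in L.
Proof.
have H : all (fun i => all (fun j => all (fun k =>
    uniq [:: i; j; k] && (pinwheel_sign i j k == 0) ==>
    has (fun L => all (mem [:: i; j; k]) L &&
      all (fun m => (pinwheel_sign i j m == 0) ==> (m \in L)) (iota 0 6)) pinwheel_lines)
  (iota 0 6)) (iota 0 6)) (iota 0 6) by vm_compute.
move=> i6 j6 k6 u s0; move/allP: H => /(_ i); rewrite mem_iota => /(_ i6).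
move/allP => /(_ j); rewrite mem_iota => /(_ j6).
move/allP => /(_ k); rewrite mem_iota => /(_ k6).
rewrite u s0 eqxx => /hasP[L L_in /andP[/allP sub /allP Lm]].
exists L => //; split=> [m /sub//|m m6 sm].
by have := Lm m; rewrite mem_iota sm eqxx; apply.
Qed.

(** Coincident points have orientation zero with every third point, so this makes the six points
    distinct. *)
Lemma pinwheel_separated (i j : nat) : (i < 6)%N -> (j < 6)%N ->
  (forall k, (k < 6)%N -> pinwheel_sign i j k = 0) -> i = j.
Proof.
have H : all (fun i => all (fun j => (i == j) ||
    has (fun k => pinwheel_sign i j k != 0) (iota 0 6)) (iota 0 6)) (iota 0 6).
  by vm_compute.
move=> i6 j6 s0; move/allP: H => /(_ i); rewrite mem_iota => /(_ i6).
move/allP => /(_ j); rewrite mem_iota => /(_ j6) /orP[/eqP//|/hasP[k]].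
by rewrite mem_iota => k6; rewrite s0 ?eqxx.
Qed.

Lemma pinwheel_is_S6 P : pinwheel P -> is_S6 P.
Proof.
move=> [a [b [c [a' [b' [c' [D0 h1 h2 h3 ->]]]]]]].
exists a, b, c, a', b', c'; set s := [:: a; b; c; a'; b'; c'].
have sg l m n := @pinwheel_sgz _ a b c a' b' c' l m n h1 h2 h3.
have sgD : sgz (orient a' b' c') \is a GRing.unit by case: sgzP D0.
have zero l m n : (l < 6)%N -> (m < 6)%N -> (n < 6)%N ->
    orient s`_l s`_m s`_n = 0 -> pinwheel_sign l m n = 0.
  move=> l6 m6 n6 /eqP; rewrite -sgz_eq0 sg// => /eqP e.
  by apply: (mulIr sgD); rewrite mul0r.
have s_uniq : uniq s.
  apply/(uniqP 0) => i j; rewrite !inE => i6 j6 e.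
  by apply: pinwheel_separated => // k k6; apply: zero => //; rewrite e orient_xxy.
split=> //.
  have u3 := uniq_nth3 s_uniq.
  by split; apply: chain3 => //; [apply: (u3 0 3 5)%N|apply: (u3 1 4 3)%N|apply: (u3 2 5 4)%N].
move=> A AP [o [v lin]] /card_ge3P[x [y [z [[Ax Ay Az] xyz]]]].
have col p q r : A p -> A q -> A r -> orient p q r = 0.
  move=> /lin[p' _ <-] /lin[q' _ <-] /lin[r' _ <-].
  by rewrite /orient !mxE; ring.
have [i i6 xE] := mem_seq_nth (AP x Ax); have [j j6 yE] := mem_seq_nth (AP y Ay).
have [k k6 zE] := mem_seq_nth (AP z Az).
have ijk : uniq [:: i; j; k].
  by move: xyz; rewrite xE yE zE -[X in uniq X]/(map (nth 0 s) [:: i; j; k]) => /map_uniq.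
have [|L L_in [subL Lm]] := pinwheel_line_table i6 j6 k6 ijk.
  by apply: zero => //; rewrite -xE -yE -zE; apply: col.
have AE : A = [set` map (nth 0 s) L].
  apply/seteqP; split=> [q Aq|q /= /mapP[m /subL + ->]].
    have [m m6 qE] := mem_seq_nth (AP q Aq); rewrite qE /=; apply: map_f.
    by apply: Lm => //; apply: zero => //; rewrite -xE -yE -qE; apply: col.
  by rewrite !inE => /or3P[]/eqP->; rewrite -?xE -?yE -?zE.
have set3E p q r : [set` [:: p; q; r]] = [set p; q; r].
  apply/seteqP; split=> n /=; rewrite !inE.
    by move=> /or3P[]/eqP->; [left; left|left; right|right].
  by move=> [[->|->]|->]; rewrite eqxx ?orbT.
move: L_in AE; rewrite !inE => /or3P[]/eqP-> /=; rewrite set3E => AE.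
- exact: Or31.
- exact: Or32.
- exact: Or33.
Qed.

Lemma S6_equivalent_pinwheel X Y : is_S6 Y -> equivalent X Y -> pinwheel X.
Proof.
move=> [a [b [c [a' [b' [c' [s_uniq YE [/chain3_sbetween h1 /chain3_sbetween h2
  /chain3_sbetween h3] colY]]]]]]] [f f_bij f_Rch].
(* If [a'], [b'], [c'] were collinear, they would form one of the three listed triples, each of
   which contains [a], [b] or [c]. *)
have D0 : orient a' b' c' != 0.
  apply/eqP => D0; have ab : a' != b'.
    by apply/eqP => e; move: s_uniq; rewrite e /= !inE eqxx ?orbT ?andbF.
  have AY : [set a'; b'; c'] `<=` Y.
    by rewrite YE => x [[->|->]|->]; rewrite /= !inE eqxx ?orbT.
  have Acol : collinear [set a'; b'; c'].
    exists a', (b' - a') => x [[->|->]|->].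
    - by exists 0 => //; rewrite scale0r addr0.
    - by exists 1 => //; rewrite scale1r addrC subrK.
    - by have [t ->] := lineP ab D0; exists t.
  have A3 : (`I_3 #<= [set a'; b'; c'])%card.
    apply/card_ge3P; exists a', b', c'; split.
      by split; [left; left|left; right|right].
    exact: (uniq_nth3 s_uniq (i := 3) (j := 4) (k := 5)).
  have nin x : x \in [:: a; b; c] -> ~ [set a'; b'; c'] x.
    move=> xabc [[xE|xE]|xE]; move: s_uniq; rewrite -[_ :: _]/([:: a; b; c] ++ [:: a'; b'; c']);
    rewrite cat_uniq => /and3P[_ /hasP []]; exists x => //; rewrite xE !inE eqxx ?orbT//.
  case: (colY _ AY Acol A3) => E.
  - by apply: (nin a); rewrite ?inE ?eqxx// E; left; left.
  - by apply: (nin b); rewrite ?inE ?eqxx ?orbT// E; left; left.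
  - by apply: (nin c); rewrite ?inE ?eqxx ?orbT// E; left; left.
have pre y : y \in [:: a; b; c; a'; b'; c'] -> exists2 x, X x & f x = y.
  by move=> ys; apply: (equiv_surj f_bij); rewrite YE.
have [|xa Xa fa] := pre a; first by rewrite !inE eqxx.
have [|xb Xb fb] := pre b; first by rewrite !inE eqxx ?orbT.
have [|xc Xc fc] := pre c; first by rewrite !inE eqxx ?orbT.
have [|xa' Xa' fa'] := pre a'; first by rewrite !inE eqxx ?orbT.
have [|xb' Xb' fb'] := pre b'; first by rewrite !inE eqxx ?orbT.
have [|xc' Xc' fc'] := pre c'; first by rewrite !inE eqxx ?orbT.
have betw x p y : X x -> X p -> X y -> f p <> f x -> f p <> f y ->
    sbetween (f x) (f p) (f y) -> sbetween x p y.
  move=> Xx Xp Xy px py /sbetween_segment/(equiv_segment f_bij f_Rch Xx Xy Xp) h.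
  by apply: segment_sbetween => // e; [apply: px|apply: py]; rewrite e.
have uE x y : x \in [:: a; b; c] -> y \in [:: a'; b'; c'] -> y <> x.
  move=> xs ys e; move: s_uniq; rewrite -[_ :: _]/([:: a; b; c] ++ [:: a'; b'; c']).
  by rewrite cat_uniq => /and3P[_ /hasP []]; exists y => //=; rewrite e.
have a'b' : a' <> b' by move=> e; move: D0; rewrite e orient_xxy eqxx.
have a'c' : a' <> c' by move=> e; move: D0; rewrite e orient_xyx eqxx.
have b'c' : b' <> c' by move=> e; move: D0; rewrite e orient_xyy eqxx.
exists xa, xb, xc, xa', xb', xc'; split.
- by apply: contra_neq D0 => /(equiv_collinear f_bij f_Rch Xa' Xb' Xc'); rewrite fa' fb' fc'.
- by apply: betw; rewrite ?fa ?fa' ?fc'//; apply: uE; rewrite !inE eqxx ?orbT.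
- by apply: betw; rewrite ?fb ?fa' ?fb'//; [apply: uE; rewrite !inE eqxx ?orbT|exact: nesym].
- by apply: betw; rewrite ?fc ?fc' ?fb'//; [apply: uE; rewrite !inE eqxx ?orbT|exact: nesym].
- apply/seteqP; split=> x /=; last first.
    by rewrite !inE => /or4P[|||/or3P[]] /eqP->.
  move=> Xx; have := equiv_mem f_bij Xx; rewrite YE /= !inE.
  have E y : X y -> (f x == f y) = (x == y).
    by move=> Xy; apply/eqP/eqP => [/(equiv_inj f_bij)->//|->].
  by rewrite -fa -fb -fc -fa' -fb' -fc' !E.
Qed.

End Sporadic.

Local Close Scope ring_scope.

Theorem theorem4p9 (R : realType) (X : set 'rV[R]_2) :
  finite_set (convex_lattice X) <->
  (exists (p q : nat) (Y : set 'rV[R]_2), is_diamond p q Y /\ subconfiguration X Y)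
  \/ (exists Y : set 'rV[R]_2, is_S6 Y /\ equivalent X Y).
Proof.
split=> [finK|[[p [q [Y [dY [Z ZY XZ]]]]]|[Y [sY XY]]]].
- have finP := lattice_points_finite finK.
  have XP := @sub_lattice_points R X.
  have cP := @lattice_points_complete R X.
  have axial_case : axial X -> exists (p q : nat) (Y : set 'rV[R]_2),
      is_diamond p q Y /\ subconfiguration X Y.
    move=> /(axial_sub_diamond (sub_finite_set XP finP))[p [q [Y [dY XY]]]].
    by exists p, q, Y; split=> //; exists X => //; exact: equivalent_refl.
  have [s PE] := (finite_seqP _).1 finP; rewrite PE in XP cP.
  have [/(axial_sub XP)|pinP] := complete_classification cP; first by left; apply: axial_case.
  have [XE|nXE] := pselect (X = [set` s]); last first.
    by left; apply: axial_case; apply: pinwheel_proper_axial pinP XP nXE.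
  right; exists X; split; last exact: equivalent_refl.
  by rewrite XE; apply: pinwheel_is_S6.
- have [x0 [x1 [s [s' [c skY]]]]] := diamond_skewered dY.
  have axX := skewered_sub_axial skY ZY XZ.
  apply: axial_finite_lattice axX; have [f f_bij _] := XZ.
  rewrite -(eq_finite_set (inj_card_eq (set_bij_inj f_bij))).
  apply: sub_finite_set (diamond_finite dY).
  by move=> _ [x Xx <-]; exact/ZY/(equiv_mem f_bij).
- have pX := S6_equivalent_pinwheel sY XY; apply: complete_finite_lattice.
    by case: pX => [a [b [c [a' [b' [c' [_ _ _ _ ->]]]]]]]; exact: finite_seq.
  exact: pinwheel_complete.
Qed.
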